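(* If there is no separable nonmetrizable Fréchet topological group, then there exists a separable sequential topological group $\mathbb G$ that is a $c_\omega$-space but not a $k_\omega$-space.
   Context: All topological spaces and groups are $T_1$ and completely regular. A space $X$ is Fréchet if whenever $x\in\overline A\subseteq X$ there is a sequence of points of $A$ converging to $x$. A space $X$ is sequential if for every non-closed $A\subseteq X$ there is a sequence of points of $A$ converging to some $x\notin A$. A space $X$ is a $k_\omega$-space (respectively, a $c_\omega$-space) if there is a countable family $\mathcal K$ of compact (respectively, countably compact) subspaces of $X$ such that $U\subseteq X$ is open in $X$ if and only if $U\cap K$ is relatively open in $K$ for every $K\in\mathcal K$. *)

(* Defs.v *)
From HB Require Import structures.
From mathcomp Require Import all_boot all_order all_algebra.
From mathcomp Require Import all_classical all_reals all_analysis.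

Set Implicit Arguments.
Unset Strict Implicit.
Unset Printing Implicit Defensive.

Local Open Scope classical_set_scope.

(* The library only has topological groups in additive, commutative form
   ([TopologicalZmodule]); these are the general, possibly non-commutative ones. *)
HB.structure Definition PreTopologicalGroup :=
  {G of Topological G & Group G}.

HB.mixin Record PreTopologicalGroup_isTopologicalGroup G
    & PreTopologicalGroup G := {
  mulg_continuous : continuous (fun x : G * G => (x.1 * x.2)%g) ;
  invg_continuous : continuous (fun x : G => (x^-1)%g) }.

#[short(type="topologicalGroupType")]
HB.structure Definition TopologicalGroup :=
  {G of PreTopologicalGroup G & PreTopologicalGroup_isTopologicalGroup G}.

(* T1 is [accessible_space].  The library phrases complete regularity as the
   separation of points from closed sets by a uniformity coarser than the
   topology; [uniform_separatorP] is the equivalence with separation by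
   continuous real-valued functions. *)
Definition tychonoff_space (T : topologicalType) : Prop :=
  accessible_space T /\ completely_regular_space T.

Definition separable_space (T : topologicalType) : Prop :=
  exists2 D : set T, countable D & dense D.

Definition metrizable_space (R : realType) (T : topologicalType) : Prop :=
  exists (M : metricType R) (f : T -> M) (g : M -> T),
    [/\ cancel f g, cancel g f, continuous f & continuous g].

Definition frechet_space (T : topologicalType) : Prop :=
  forall (A : set T) (x : T), closure A x ->
    exists2 u : nat -> T, (forall n, A (u n)) & u @ \oo --> x.

Definition sequential_space (T : topologicalType) : Prop :=
  forall A : set T, ~ closed A ->
    exists (u : nat -> T) (x : T),
      [/\ forall n, A (u n), u @ \oo --> x & ~ A x].

(* Covers are by open sets of the ambient space, as in [cover_compact]; a
   family indexed by [nat] may repeat sets or contain [set0], so all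
   countable covers are included. *)
Definition countably_compact (T : topologicalType) (A : set T) : Prop :=
  forall U : nat -> set T, (forall n, open (U n)) ->
    A `<=` \bigcup_n U n -> finite_subset_cover setT U A.

(* [subspace K] keeps the carrier [T] and makes the points outside [K] isolated,
   so [U `&` K] is open in it iff it is relatively open in [K]. *)
Definition determined_by (T : topologicalType) (F : set (set T)) : Prop :=
  forall U : set T,
    open U <-> (forall K, F K -> @open (subspace K) (U `&` K)).

Definition k_omega_space (T : topologicalType) : Prop :=
  exists F : set (set T),
    [/\ countable F, forall K, F K -> compact K & determined_by F].

Definition c_omega_space (T : topologicalType) : Prop :=
  exists F : set (set T),
    [/\ countable F, forall K, F K -> countably_compact K & determined_by F].

(* Main.v *)
Require Import Defs.
From HB Require Import structures.
From mathcomp Require Import finmap all_boot all_order all_algebra.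
From mathcomp Require Import all_classical all_reals all_analysis.
From mathcomp Require Import wochoice zify.

(* Call a strictly increasing sequence (T a), a < omega_1, of subsets of nat
   modulo finite sets a maximal tower when no infinite set is almost disjoint
   from all the T a.

   If there is no maximal tower, then every omega_1-sequence of functions is
   dominated (b > omega_1), and then every filter base of size omega_1 has a
   pseudo-intersection (p > omega_1).  The clopen Z/2-valued functions on a set
   Y of omega_1 points of the Cantor space form a countable group in the
   topology of pointwise convergence; it has weight omega_1, so it is Frechet,
   but it is not metrizable as Y is uncountable.

   A maximal tower yields the Franklin-Rajagopalan space X = nat + omega_1: it
   is separable, sequentially compact, not compact, and any sequentially closed
   Z in X * X off the diagonal misses the equivalence relation of some finite
   clopen partition (a pressing-down argument).  The free Boolean topological
   group G of X has, for sequences s of finite clopen partitions, the basic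
   neighbourhoods { sum_(i < n) (x_i + y_i) | x_i, y_i in one cell of s_i }.
   If A meets each set K_n of sums of n generators in a relatively sequentially
   closed set and misses g, then s is built by induction so that no partial sum
   leads from g to A: the sums of length n form a sequentially compact set, so
   the pairs (x, y) that are forbidden at the next step form a sequentially
   closed set off the diagonal.  Hence G is sequential and determined by the
   countably compact K_n.  If G were k_omega, then X would lie in a compact
   subset of G, which is impossible as X is not compact and the image in G of
   a sequentially closed subset of X is closed. *)

Set Implicit Arguments.
Unset Strict Implicit.
Unset Printing Implicit Defensive.
Import Order.TTheory GRing.Theory Num.Theory.
Local Open Scope classical_set_scope.

(** * Almost inclusion and omega_1 *)

Definition almost_sub (A B : set nat) :=
  exists m, forall n, m <= n -> A n -> B n.

Definition infinite_nat (A : set nat) := forall m, exists2 n, m <= n & A n.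

Lemma almost_sub_trans B A C :
  almost_sub A B -> almost_sub B C -> almost_sub A C.
Proof.
move=> [m AB] [p BC]; exists (maxn m p) => n; rewrite geq_max => /andP[mn pn] An.
exact: BC pn (AB _ mn An).
Qed.

Lemma almost_subW A B : A `<=` B -> almost_sub A B.
Proof. by move=> AB; exists 0 => n _ /AB. Qed.

Lemma infinite_almost_sub A B : infinite_nat A -> almost_sub A B -> infinite_nat B.
Proof.
move=> iA [m AB] p; have [n] := iA (maxn m p).
by rewrite geq_max => /andP[mn pn] An; exists n => //; exact: AB.
Qed.

Lemma not_infinite_natP A :
  ~ infinite_nat A <-> exists m, forall n, m <= n -> ~ A n.
Proof.
split=> [/existsNP[m nA]|[m nA] /(_ m)[n mn An]]; last exact: nA mn An.
by exists m => n mn An; apply: nA; exists n.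
Qed.

Lemma not_infinite_diffP A B : ~ infinite_nat (A `\` B) <-> almost_sub A B.
Proof.
rewrite not_infinite_natP; split=> -[m AB]; exists m => n mn.
  by move=> An; apply: contrapT => nBn; apply: (AB n mn).
by case=> An; apply; exact: AB.
Qed.

Lemma infinite_enum (A : set nat) (R : nat -> nat -> Prop) :
  (forall m, exists2 n, A n & R m n) ->
  exists u : nat -> nat, forall k, A (u k) /\ R (u k) (u k.+1).
Proof.
move=> h; have /choice[f hf] : forall m, exists n, A n /\ R m n.
  by move=> m; have [n] := h m; exists n.
exists (fun k => iter k.+1 f 0) => k; split; [exact: (hf _).1|exact: (hf _).2].
Qed.

Definition increasing (u : nat -> nat) := forall k, u k < u k.+1.

Lemma increasing_ltn u : increasing u -> {homo u : i j / i < j}.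
Proof. by move=> iu; apply: homo_ltn => //; exact: ltn_trans. Qed.

Lemma increasing_leq u : increasing u -> {homo u : i j / i <= j}.
Proof.
by move=> iu i j; rewrite leq_eqVlt => /predU1P[->//|/(increasing_ltn iu)/ltnW].
Qed.

Lemma increasing_ge u : increasing u -> forall k, k <= u k.
Proof. by move=> iu; elim=> // k IH; exact: leq_ltn_trans IH (iu k). Qed.

Lemma increasing_comp u v :
  increasing u -> increasing v -> increasing (fun k => u (v k)).
Proof. by move=> iu iv k; exact/increasing_ltn/iv. Qed.

Lemma infinite_subseq A : infinite_nat A ->
  exists2 u, increasing u & forall k, A (u k).
Proof.
move=> iA; have [m|u hu] := @infinite_enum A (fun m n => m < n).
  by have [n] := iA m.+1; exists n.
by exists u => k; have [] := hu k.
Qed.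

(* Up to isomorphism, the only such well order is [omega_1]. *)
Record omega1 := Omega1 {
  idx :> Type;
  lt1 : idx -> idx -> Prop;
  lt1_inh : inhabited idx;
  lt1_wf : well_founded lt1;
  lt1_trans : forall y x z, lt1 x y -> lt1 y z -> lt1 x z;
  lt1_total : forall x y, [\/ lt1 x y, x = y | lt1 y x];
  lt1_enum : forall a, exists e : nat -> idx,
    forall b, ~ lt1 a b -> exists n, e n = b;
  lt1_bound : forall u : nat -> idx, exists g, forall k, lt1 (u k) g }.
Arguments lt1 {_}.

Section omega1_theory.
Variable O : omega1.
Implicit Types a b c : O.

Lemma lt1_irr a : ~ lt1 a a.
Proof. by elim/(well_founded_ind (@lt1_wf O)): a => a IH aa; exact: (IH a aa aa). Qed.

Lemma lt1_asym a b : lt1 a b -> ~ lt1 b a.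
Proof. by move=> ab /(lt1_trans ab); exact: lt1_irr. Qed.

Lemma lt1_min (P : O -> Prop) : (exists a, P a) ->
  exists2 a, P a & forall b, lt1 b a -> ~ P b.
Proof.
move=> [a0 Pa0]; apply: contrapT => /forall2NP nP.
suff: forall a, ~ P a by move/(_ a0).
elim/(well_founded_ind (@lt1_wf O)) => a IH Pa.
by case: (nP a) => // /existsNP[b /not_implyP[ba /contrapT Pb]]; exact: IH b ba Pb.
Qed.

Lemma nlt1P a b : ~ lt1 a b <-> lt1 b a \/ b = a.
Proof.
split=> [|[ba|->]]; [|exact: lt1_asym|exact: lt1_irr].
by case: (lt1_total a b) => // [->|]; [right|left].
Qed.

Lemma nlt1_trans b a c : ~ lt1 a b -> ~ lt1 b c -> ~ lt1 a c.
Proof.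
move=> /nlt1P ba /nlt1P cb; apply/nlt1P.
case: ba cb => [ba|->] [cb|->]; [|by left|by left|by right].
by left; exact: lt1_trans ba.
Qed.

Lemma lt1_bound_seq (T : Type) (f : T -> O) (s : seq T) :
  exists g, forall t, List.In t s -> lt1 (f t) g.
Proof.
elim: s => [|x s [g hg]]; first by have [a] := lt1_inh O; exists a.
have [h] := lt1_bound (fun n : nat => if n is 0 then f x else g).
move=> hh; exists h => t [<-|/hg tg]; first exact: (hh 0).
exact: lt1_trans tg (hh 1).
Qed.

End omega1_theory.

(** Lets a tower be indexed by the cofinal set of places where a given sequence properly
    decreases. *)
Program Definition omega1_sub (O : omega1) (S : O -> Prop)
    (cS : forall g, exists2 s, S s & lt1 g s) : omega1 :=
  @Omega1 {x : O | S x} (fun x y => lt1 (sval x) (sval y)) _ _ _ _ _ _.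
Next Obligation.
move=> O S cS; have [a] := lt1_inh O; have [s Ss _] := cS a.
by constructor; exists s.
Qed.
Next Obligation.
move=> O S cS; case=> x; elim/(well_founded_ind (@lt1_wf O)): x => x IH Sx.
by constructor=> -[y Sy] yx; exact: IH.
Qed.
Next Obligation. by move=> O S cS [y ?] [x ?] [z ?] /=; exact: lt1_trans. Qed.
Next Obligation.
move=> O S cS [x Sx] [y Sy] /=; case: (lt1_total x y) => h.
- exact: Or31.
- by apply: Or32; exact: eq_exist.
- exact: Or33.
Qed.
Next Obligation.
move=> O S cS [a Sa] /=; have [e he] := lt1_enum a.
have /choice[f hf] : forall n, exists x : {x | S x}, S (e n) -> sval x = e n.
  move=> n; case: (pselect (S (e n))) => [Sn|nSn].
    by exists (exist _ _ Sn).
  by exists (exist _ _ Sa).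
exists f => -[b Sb] /= /he[n hn]; exists n; apply: eq_sig_hprop => /=.
  by move=> ? ? ?; exact: Prop_irrelevance.
by rewrite hf hn.
Qed.
Next Obligation.
move=> O S cS u; have [g hg] := lt1_bound (fun k => sval (u k)).
by have [s Ss gs] := cS g; exists (exist _ _ Ss) => k /=; exact: lt1_trans gs.
Qed.

(** In a well-order [R] of the Cantor space, the points with countably many predecessors form a copy
    of omega_1. *)
Lemma omega1_cantor : exists (O : omega1) (f : O -> nat -> bool), injective f.
Proof.
have [R wR] := well_ordering_principle (nat -> bool : eqType).
have ex_min (P : (nat -> bool) -> Prop) : (exists x, P x) ->
    exists2 x, P x & forall y, P y -> R x y.
  move=> [x Px]; have [|z [[Az lz] _]] := wR [pred x | `[< P x >]].
    by exists x; apply/asboolP.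
  by exists z => [|y Py]; [exact/asboolP|apply: lz; exact/asboolP].
have Rtot x y : R x y \/ R y x.
  have [|z [->|->] h] := ex_min (fun z => z = x \/ z = y); first by exists x; left.
    by left; apply: h; right.
  by right; apply: h; left.
have Rxx x : R x x by case: (Rtot x x).
have Ranti x y : R x y -> R y x -> x = y.
  move=> xy yx; have [|z [[_ _] u]] := wR [pred z | (z == x) || (z == y)].
    by exists x; rewrite inE eqxx.
  have ex : z = x.
    apply: u; split; first by rewrite inE eqxx.
    by move=> t; rewrite inE => /orP[]/eqP->.
  have ey : z = y.
    apply: u; split; first by rewrite inE eqxx orbT.
    by move=> t; rewrite inE => /orP[]/eqP->.
  by rewrite -ex.
have Rtr y x z : R x y -> R y z -> R x z.
  move=> xy yz.
  have [|t ht ht'] := ex_min (fun t => [\/ t = x, t = y | t = z]).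
    by exists x; exact: Or31.
  case: ht ht' => -> h; [by apply: h; exact: Or33| |].
    have e : x = y by apply: Ranti xy (h _ _); exact: Or31.
    by rewrite e.
  have e : y = z by apply: Ranti yz (h _ _); exact: Or32.
  by rewrite -e.
pose cnt x := exists e : nat -> nat -> bool, forall y, R y x -> exists n, e n = y.
pose lt (x y : {x | cnt x}) := R (sval x) (sval y) /\ sval x <> sval y.
have nlt x y : ~ lt x y -> R (sval y) (sval x).
  move=> nxy; case: (Rtot (sval y) (sval x)) => // xy.
  case: (pselect (sval x = sval y)) => [->//|ne].
  by exfalso; apply: nxy.
have inh : inhabited {x | cnt x}.
  have [|m _ hm] := ex_min (fun=> True); first by exists xpred0.
  constructor; exists m; exists (fun=> m) => y ym; exists 0.
  by apply: Ranti (hm _ _) _.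
have wf : well_founded lt.
  apply: contrapT => /existsNP[x nx].
  have [|m [c nm] hm] := ex_min (fun z => exists c : cnt z, ~ Acc lt (exist _ z c)).
    by case: x nx => x c nx; exists x; exists c.
  apply: nm; constructor => -[y cy] [/= ym ne].
  apply: contrapT => ny; apply: ne; apply: Ranti ym (hm _ _).
  by exists cy.
have tr y x z : lt x y -> lt y z -> lt x z.
  move=> [xy nxy] [yz nyz]; split; first exact: Rtr yz.
  by move=> e; apply: nxy; apply: Ranti xy _; rewrite e.
have tot x y : [\/ lt x y, x = y | lt y x].
  case: (pselect (sval x = sval y)) => e.
    apply: Or32; case: x y e => x cx [y cy] /= e; exact: eq_exist.
  case: (Rtot (sval x) (sval y)) => h; [apply: Or31|apply: Or33]; split=> //.
  by move=> e'; apply: e.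
have enum a : exists e : nat -> {x | cnt x}, forall b, ~ lt a b -> exists n, e n = b.
  case: (a) => x [e he].
  have /choice[f hf] : forall n, exists x : {x | cnt x}, cnt (e n) -> sval x = e n.
    move=> n; case: (pselect (cnt (e n))) => [cn|ncn].
      by exists (exist _ _ cn).
    by exists a.
  exists f => -[y cy] /nlt /= /he[n hn]; exists n.
  have : sval (f n) = y by rewrite hf hn.
  by case: (f n) => z cz /= ezy; exact: eq_exist.
have bnd (u : nat -> {x | cnt x}) : exists g, forall k, lt (u k) g.
  apply: contrapT => nb.
  have nb' (g : {x | cnt x}) : exists k, R (sval g) (sval (u k)).
    apply: contrapT => ng; apply: nb; exists g => k; apply: contrapT => /nlt h.
    by apply: ng; exists k.
  have /choice[E hE] k : exists e : nat -> nat -> bool,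
      forall y, R y (sval (u k)) -> exists n, e n = y.
    exact: (svalP (u k)).
  pose e n := if unpickle n is Some (k, j) then E k j else E 0 0.
  have he y : cnt y -> exists n, e n = y.
    move=> cy; have [k /= /hE[j hj]] := nb' (exist _ y cy).
    by exists (pickle (k, j)); rewrite /e pickleK.
  (* With [u] unbounded, [e] enumerates all of [cnt], so the diagonal point escapes [cnt]. The least
     point outside [cnt] has, apart from itself, only predecessors in [cnt], hence countably many: a
     contradiction. *)
  have [x nx] : exists x, ~ cnt x.
    exists (fun n => ~~ e n n) => /he[n hn].
    by have := congr1 (fun f => f n) hn; case: (e n n).
  have [|m nm hm] := ex_min (fun x => ~ cnt x); first by exists x.
  apply: nm; exists (fun n => if n is n'.+1 then e n' else m) => y ym.
  case: (pselect (cnt y)) => [/he[n hn]|/hm my]; first by exists n.+1.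
  by exists 0; exact: Ranti.
exists (@Omega1 {x | cnt x} lt inh wf tr tot enum bnd), (@sval _ _).
by move=> [x cx] [y cy] /= e; exact: eq_exist.
Qed.

(** * Consequences of the absence of maximal towers *)

Record maximal_tower (O : omega1) (T : O -> set nat) : Prop := MaximalTower {
  tower_sub : forall a b, lt1 a b -> almost_sub (T a) (T b);
  tower_strict : forall a b, lt1 a b -> infinite_nat (T b `\` T a);
  tower_maximal : forall A, infinite_nat A -> exists a, infinite_nat (A `&` T a) }.

Section no_maximal_tower.
Hypothesis no_tower : forall (O : omega1) (T : O -> set nat), ~ maximal_tower T.

(** Let [S] be the set of places where [B] drops properly. If [S] is cofinal, the complements of the
    [B a] over [S] form a tower; it is not maximal, and an infinite set almost disjoint from its
    members is the [P] sought. If [S] is bounded by [g], [B] drops no further modulo finite sets and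
    [B g] works. *)
Lemma pseudo_intersection (O : omega1) (B : O -> set nat) :
  (forall a, infinite_nat (B a)) ->
  (forall a b, lt1 a b -> almost_sub (B b) (B a)) ->
  exists2 P, infinite_nat P & forall a, almost_sub P (B a).
Proof.
move=> iB sB.
pose S a := forall b, lt1 b a -> infinite_nat (B b `\` B a).
(* The least index whose set is almost contained in [B a] belongs to [S]. *)
have SP a : exists2 b, S b & almost_sub (B b) (B a).
  have [|b Pb mb] := @lt1_min O (fun b => almost_sub (B b) (B a)).
    by exists a; exact: almost_subW.
  exists b => // c cb; apply: contrapT => /not_infinite_diffP BcBb.
  by apply: (mb c cb); exact: almost_sub_trans Pb.
case: (pselect (forall g, exists2 s, S s & lt1 g s)) => [cS|].
  pose O' := omega1_sub cS.
  have := @no_tower O' (fun x => ~` B (sval x)).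
  (* The first two tower conditions hold, so it is maximality that fails. *)
  move/(contra_not (fun h => let '(And3 a b c) := h in MaximalTower a b c)).
  move=> /not_and3P[/existsNP[x /existsNP[y /not_implyP[xy nxy]]]|
                    /existsNP[x /existsNP[y /not_implyP[xy nxy]]]|
                    /existsNP[A /not_implyP[iA nA]]].
  - exfalso; apply: nxy; have [m hm] := sB _ _ xy.
    by exists m => n mn + Bn; apply; exact: hm.
  - exfalso; apply: nxy => m; have [n mn [Bx By]] := svalP y _ xy m.
    by exists n => //; split=> // nBx; exact: nBx.
  - exists A => // a; have [b Sb Bba] := SP a; apply: almost_sub_trans Bba.
    apply/not_infinite_diffP => iAB; apply: nA; exists (exist _ b Sb) => m.
    by have [n mn [An nBn]] := iAB m; exists n.
move=> /existsNP[g /forall2NP hg]; exists (B g) => // a.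
have [b Sb Bba] := SP a; apply: almost_sub_trans Bba.
by case: (hg b) => // /nlt1P[/sB//|->]; exact: almost_subW.
Qed.

(** Transfinite recursion: stage [a] extends an almost decreasing sequence of [Good] sets by one
    that satisfies [Q a]. Only countably many stages precede it, so [step] applies;
    [pseudo_intersection] then handles the whole sequence. *)
Lemma tower_construction (O : omega1) (Good : set nat -> Prop)
    (Q : O -> set nat -> Prop) :
  Good setT ->
  (forall B, Good B -> infinite_nat B) ->
  (forall B C, Good B -> almost_sub B C -> Good C) ->
  (forall a B P, Q a B -> almost_sub P B -> Q a P) ->
  (forall (C : nat -> set nat) a, (forall n, Good (C n)) ->
     (forall n, C n.+1 `<=` C n) ->
     exists B, [/\ Good B, Q a B & forall n, almost_sub B (C n)]) ->
  exists2 P, infinite_nat P & forall a, Q a P.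
Proof.
move=> GT Ginf Gsup Qsub step.
pose spec a (D : O -> set nat) (B : set nat) :=
  [/\ Good B, Q a B & forall b, lt1 b a -> almost_sub B (D b)].
have ex a (D : O -> set nat) : (forall b, lt1 b a -> spec b D (D b)) ->
    exists B, spec a D B.
  move=> hD; have [e he] := lt1_enum a.
  (* Finite intersections turn the earlier stages into a truly decreasing sequence. They stay
     [Good], because each [C n] almost contains some earlier stage or all of [nat]. *)
  pose C n : set nat := [set k | forall j, j <= n -> lt1 (e j) a -> D (e j) k].
  have hC n : almost_sub setT (C n) \/ exists2 b, lt1 b a & almost_sub (D b) (C n).
    elim: n => [|n IH].
      case: (pselect (lt1 (e 0) a)) => [h|h]; [right|left].
        by exists (e 0) => //; exists 0 => k _ Dk j; rewrite leqn0 => /eqP->.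
      by exists 0 => k _ _ j; rewrite leqn0 => /eqP-> /h.
    have CS b : almost_sub b (C n) ->
        (lt1 (e n.+1) a -> almost_sub b (D (e n.+1))) -> almost_sub b (C n.+1).
      move=> [m hm]; case: (pselect (lt1 (e n.+1) a)) => [h|h].
        move=> /(_ h)[p hp]; exists (maxn m p) => k.
        rewrite geq_max => /andP[mk pk] bk j.
        by rewrite leq_eqVlt => /predU1P[->|] *; [exact: hp|exact: hm].
      move=> _; exists m => k mk bk j.
      by rewrite leq_eqVlt => /predU1P[->/h//|] *; exact: hm.
    case: (pselect (lt1 (e n.+1) a)) IH => [h|h] [IH|[b ba IH]].
    - right; exists (e n.+1) => //; apply: CS => [|_]; last exact: almost_subW.
      by apply: almost_sub_trans IH; exact: almost_subW.
    - right; case: (lt1_total b (e n.+1)) => hb.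
      + have [_ _ /(_ _ hb) hs] := hD _ h.
        exists (e n.+1) => //; apply: CS => [|_]; last exact: almost_subW.
        exact: almost_sub_trans IH.
      + exists b => //; apply: CS => // _; rewrite hb; exact: almost_subW.
      + by exists b => //; apply: CS => // _; have [_ _ /(_ _ hb)] := hD _ ba.
    - by left; exact: CS.
    - by right; exists b => //; exact: CS.
  have [||B [GB QB BC]] := step C a.
  - move=> n; case: (hC n) => [|[b ba]]; first exact: Gsup.
    by apply: Gsup; case: (hD _ ba).
  - by move=> n k Ck j jn; apply: Ck; exact: leqW.
  exists B; split=> // b ba; have [|n en] := he b; first exact: lt1_asym.
  by apply: almost_sub_trans (BC n) _; apply: almost_subW => k; rewrite -en; apply;
     rewrite ?en.
(* The default [set0] is never taken: [ex] provides a set at every stage. *)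
pose F a (rec : forall b, lt1 b a -> set nat) : set nat :=
  xget set0 [set B | [/\ Good B, Q a B & forall b h, almost_sub B (rec b h)]].
pose D := Fix (@lt1_wf O) (fun=> set nat) F.
have DE a : D a = F a (fun b _ => D b).
  rewrite /D Fix_eq // => x f g fg; congr F.
  by apply: functional_extensionality_dep => b; apply: funext.
have hD a : spec a D (D a).
  elim/(well_founded_ind (@lt1_wf O)): a => a IH.
  by have [B hB] := ex a D IH; rewrite DE; exact: (xgetPex set0 (ex_intro _ B hB)).
have [a|a b ab|P iP hP] := @pseudo_intersection O D.
- by apply: Ginf; case: (hD a).
- by case: (hD b) => _ _; apply.
by exists P => // a; apply: Qsub (hP a); case: (hD a).
Qed.

(* The next-element function of a sufficiently thin infinite set dominates. *)
Lemma dominating_function (O : omega1) (f : O -> nat -> nat) :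
  exists g : nat -> nat, forall a, exists m, forall n, m <= n -> f a n <= g n.
Proof.
(* [f'] is nondecreasing and majorizes [f], so a bound at a later argument serves for an earlier
   one. *)
pose f' a n := \max_(i < n.+1) f a i.
have ff' a n : f a n <= f' a n by exact: (leq_bigmax (Ordinal (ltnSn n))).
have f'mono a n m : n <= m -> f' a n <= f' a m.
  move=> nm; apply/bigmax_leqP => i _.
  pose j : 'I_m.+1 := Ordinal (leq_trans (ltn_ord i) (nm : n < m.+1)).
  exact: (@leq_bigmax _ (fun j : 'I_m.+1 => f a j) j).
(* From some point on, each element of [B] lies beyond the value of [f' a] at every smaller one. *)
pose Q a (B : set nat) := exists m, forall x y, m <= x -> x < y -> B x -> B y -> f' a x < y.
have [|//|||C a iC dC|P iP QP] := @tower_construction O infinite_nat Q.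
- by move=> m; exists m.
- exact: infinite_almost_sub.
- move=> a B P [m hm] [p hp]; exists (maxn m p) => x y.
  rewrite geq_max => /andP[mx px] xy Px Py.
  by apply: hm => //; apply: hp => //; exact: ltnW (leq_ltn_trans px xy).
- have Cmono n m : n <= m -> C m `<=` C n.
    elim: m => [|m IH]; first by rewrite leqn0 => /eqP->.
    by rewrite leq_eqVlt => /predU1P[->//|/IH h] k /dC/h.
  have /choice[b hb] (nm : nat * nat) : exists k, nm.2 <= k /\ C nm.1 k.
    by have [k] := iC nm.1 nm.2; exists k.
  pose u := fix u n := if n is n'.+1 then b (n, maxn (u n').+1 (f' a (u n')).+1)
                       else b (0, 0).
  have uC n : C n (u n) by case: n => [|n]; [exact: (hb (0, 0)).2|exact: (hb (n.+1, _)).2].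
  have uS n : u n < u n.+1 /\ f' a (u n) < u n.+1.
    by have [+ _] := hb (n.+1, maxn (u n).+1 (f' a (u n)).+1); rewrite geq_max => /andP.
  have iu : increasing u by move=> n; case: (uS n).
  exists (range u); split.
  + by move=> m; exists (u m); [exact: increasing_ge|exists m].
  + exists 0 => x y _ xy [i _ ix] [j _ jy]; move: xy.
    rewrite -ix -jy (leqW_mono (leq_mono (increasing_ltn iu))).
    by move=> ij; apply: leq_trans (uS i).2 _; exact: increasing_leq.
  + move=> n; exists (u n) => k nk [i _ ik]; move: nk.
    rewrite -ik (leq_mono (increasing_ltn iu)) => ni; exact: Cmono ni _ (uC i).
(* [g n] is the upper one of two elements of [P] from [n] on; for large [n] it exceeds the majorant
   at the lower one. *)
have /choice[g hg] n : exists b, exists a, [/\ P a, P b, n <= a & a < b].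
  by have [a na Pa] := iP n; have [b ab Pb] := iP a.+1; exists b, a.
exists g => a; have [m hm] := QP a; exists m => n mn.
have [x [Px Pg nx xg]] := hg n; apply: ltnW; apply: leq_ltn_trans (ff' a n) _.
by apply: leq_ltn_trans (f'mono a _ _ nx) _; apply: hm => //; exact: leq_trans nx.
Qed.

(** Finite sequences of indices not above a common [a] are coded by natural numbers through the
    enumeration [e a], so a single [h a] eventually majorizes [f s] for all these [s]. *)
Lemma dominating_function_seq (O : omega1) (f : seq O -> nat -> nat) :
  exists g : nat -> nat, forall s, exists m, forall n, m <= n -> f s n <= g n.
Proof.
have [e he] := choice (@lt1_enum O).
pose h a n := \max_(k < n.+1)
  f (map (e a) (odflt [::] (unpickle k : option (seq nat)))) n.
have [g hg] := dominating_function h; exists g => s.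
have [a ha] : exists a : O, forall t, List.In t s -> ~ lt1 a t.
  elim: s => [|x s [a ha]]; first by have [a] := lt1_inh O; exists a.
  case: (pselect (lt1 a x)) => ax; last by exists a => t [<-|/ha].
  exists x => t [->|/ha /nlt1P[ta|->]]; [exact: lt1_irr| |exact: lt1_asym].
  by apply: lt1_asym; exact: lt1_trans ax.
have [l hl] : exists l, s = map (e a) l.
  elim: s ha => [|x s IH] ha; first by exists [::].
  have [|l ->] := IH; first by move=> t ts; apply: ha; right.
  by have [|n hn] := he a x; [apply: ha; left|exists (n :: l); rewrite /= hn].
have [m hm] := hg a; exists (maxn m (pickle l)) => n.
rewrite geq_max => /andP[mn ln]; apply: leq_trans (hm n mn).
pose i : 'I_n.+1 := Ordinal (ln : pickle l < n.+1).
have -> : s = map (e a) (odflt [::] (unpickle i : option (seq nat))).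
  by rewrite (pickleK l : unpickle i = _) hl.
by rewrite /h; exact: (leq_bigmax i).
Qed.

(* [C n] is diagonalised against all finite intersections of the [V a] at once,
   below a function that dominates the corresponding choice functions. *)
Lemma filter_pseudo_intersection (O : omega1) (A : set nat) (V : O -> set nat) :
  (forall s : seq O, infinite_nat (A `&` [set n | forall a, List.In a s -> V a n])) ->
  exists2 P, infinite_nat P & P `<=` A /\ forall a, almost_sub P (V a).
Proof.
move=> iAV; pose VV (s : seq O) : set nat := [set n | forall a, List.In a s -> V a n].
pose Good B := forall s, infinite_nat (B `&` (A `&` VV s)).
pose Q a (B : set nat) := almost_sub B (A `&` V a).
have [|B GB|B C GB [m BC] s p|a B P QB PB|C a GC dC|P iP QP] :=
    @tower_construction O Good Q.
- by move=> s; rewrite setTI; exact: iAV.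
- by move=> m; have [n mn [Bn _]] := GB [::] m; exists n.
- have [n] := GB s (maxn m p); rewrite geq_max => /andP[mn pn] [Bn h].
  by exists n => //; split=> //; exact: BC.
- exact: almost_sub_trans PB QB.
- have /choice[f hf] (sn : seq O * nat) : exists k, sn.2 <= k /\
      (C sn.2 `&` (A `&` VV (a :: sn.1))) k.
    by have [k ? ?] := GC sn.2 (a :: sn.1) sn.2; exists k.
  have [g hg] := dominating_function_seq (fun s n => f (s, n)).
  (* Level [n] contributes elements of [C n] up to [g n]. Domination makes the union large enough to
     be [Good], and the bound makes it almost contained in each [C n]. *)
  exists [set k | exists n, [/\ n <= k, k <= g n & (C n `&` (A `&` V a)) k]]; split.
  + move=> s m; have [p hp] := hg s; pose n := maxn m p.
    have [nk [Ck [Ak Vk]]] := hf (s, n); exists (f (s, n)).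
      exact: leq_trans (leq_maxl _ _) nk.
    split; last by split=> // b bs; apply: Vk; right.
    exists n; split=> //; first by apply: hp; exact: leq_maxr.
    by split=> //; split=> //; apply: Vk; left.
  + by apply: almost_subW => k [n [_ _ []]].
  (* Beyond all [g i] with [i < n], only levels from [n] on contribute. *)
  + move=> n; exists (\max_(i < n) g i).+1 => k hk [i [_ kg [Cik _]]].
    have [ni|ni] := leqP n i.
      elim: i {kg} ni Cik => [|i IH]; first by rewrite leqn0 => /eqP->.
      by rewrite leq_eqVlt => /predU1P[->//|ni] /dC; exact: IH.
    have : g i <= \max_(i < n) g i by exact: (leq_bigmax (Ordinal ni)).
    by move=> h; move: hk; rewrite ltnNge (leq_trans kg h).
have [a0] := lt1_inh O.
exists (P `&` A); [|split].
- apply: infinite_almost_sub iP _; have [m hm] := QP a0.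
  by exists m => n mn Pn; split=> //; case: (hm n mn Pn).
- exact: subIsetr.
- move=> a; apply: almost_sub_trans (_ : almost_sub P _).
    by apply: almost_subW; exact: subIsetl.
  by apply: almost_sub_trans (QP a) _; apply: almost_subW; exact: subIsetr.
Qed.

End no_maximal_tower.

(** * Topological Boolean groups *)

(** A group of exponent two with a neighbourhood base at the identity. Each element is its own
    inverse, so [bg_op x y] is also the difference of [x] and [y]. *)
Record boolean_group_base := BooleanGroupBase {
  bg_car : Type;
  bg_op : bg_car -> bg_car -> bg_car;
  bg_one : bg_car;
  bg_opA : associative bg_op;
  bg_opC : commutative bg_op;
  bg_op1 : left_id bg_one bg_op;
  bg_opxx : forall x, bg_op x x = bg_one;
  bg_idx : Type;
  bg_idx0 : bg_idx;
  bg_nbhs : bg_idx -> set bg_car;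
  bg_nbhs1 : forall i, bg_nbhs i bg_one;
  bg_nbhsM : forall i, exists j, forall x y,
    bg_nbhs j x -> bg_nbhs j y -> bg_nbhs i (bg_op x y);
  bg_nbhsI : forall i j, exists k, bg_nbhs k `<=` bg_nbhs i `&` bg_nbhs j }.

Definition boolean_group (B : boolean_group_base) : Type := bg_car B.

Section boolean_group.
Variable B : boolean_group_base.
Local Notation G := (boolean_group B).
Local Notation op := (@bg_op B).

(** The group uniformity; defining the topology through it gives complete regularity. *)
Definition bg_ent (i : bg_idx B) : set (G * G) :=
  [set xy | bg_nbhs i (op xy.1 xy.2)].

HB.instance Definition _ := gen_eqMixin G.
HB.instance Definition _ := gen_choiceMixin G.
HB.instance Definition _ := isPointed.Build G (bg_one B).

Let ent : set_system (G * G) := filter_from setT bg_ent.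

Let ent_filter : Filter ent.
Proof.
apply: filter_from_filter; first by exists (bg_idx0 B).
by move=> i j _ _; have [k hk] := bg_nbhsI i j; exists k => // -[x y] /hk.
Qed.

Let ent_diag A : ent A -> diagonal `<=` A.
Proof.
move=> [i _ iA] [x y] xy; apply: iA; rewrite /bg_ent /= (xy : x = y) bg_opxx.
exact: bg_nbhs1.
Qed.

Let ent_inv A : ent A -> ent (A^-1)%relation.
Proof.
move=> [i _ iA]; exists i => // -[x y] xy; apply: iA.
by rewrite /bg_ent /= bg_opC.
Qed.

Let ent_split A : ent A -> exists2 C, ent C & (C \; C `<=` A)%relation.
Proof.
move=> [i _ iA]; have [j hj] := bg_nbhsM i.
exists (bg_ent j); first by exists j.
move=> [x z] [y /= xy yz]; apply: iA; rewrite /bg_ent /=.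
have -> : op x z = op (op x y) (op y z).
  by rewrite -bg_opA (bg_opA y) bg_opxx bg_op1.
exact: hj.
Qed.

HB.instance Definition _ := isUniform.Build G ent_filter ent_diag ent_inv ent_split.

Lemma bg_op1r : right_id (@bg_one B) op.
Proof. by move=> x; rewrite bg_opC bg_op1. Qed.

HB.instance Definition _ := @isGroup.Build G (@bg_one B) id op
  (@bg_opA B) (@bg_op1 B) bg_op1r (@bg_opxx B) (@bg_opxx B).

Lemma nbhs_bgP (x : G) (A : set G) :
  nbhs x A <-> exists i, forall y, bg_nbhs i (op x y) -> A y.
Proof.
rewrite -nbhs_entourageE; split=> [[C [i _ iC] CA]|[i iA]].
  by exists i => y xy; apply: CA; apply/mem_set; exact: iC.
by exists (bg_ent i); [exists i|move=> y /set_mem; exact: iA].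
Qed.

Lemma bg_op_cancel (x x' y y' : G) :
  op (op x y) (op x' y') = op (op x x') (op y y').
Proof. by rewrite -!bg_opA (bg_opA y) (bg_opC y) -(bg_opA x'). Qed.

Let mul_cont : continuous (fun x : G * G => (x.1 * x.2)%g).
Proof.
move=> [x y] A /nbhs_bgP[i iA].
have [j hj] := bg_nbhsM i.
exists ([set x' | bg_nbhs j (op x x')], [set y' | bg_nbhs j (op y y')]).
  by split; apply/nbhs_bgP; exists j.
by move=> [x' y'] [/= xx' yy']; apply: iA; rewrite bg_op_cancel; exact: hj.
Qed.

Let inv_cont : continuous (fun x : G => (x^-1)%g).
Proof. by move=> x A. Qed.

HB.instance Definition _ :=
  PreTopologicalGroup_isTopologicalGroup.Build G mul_cont inv_cont.

Lemma bg_cvgP (u : nat -> G) (x : G) :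
  u @ \oo --> x <-> forall i, exists m, forall n, (m <= n)%N -> bg_nbhs i (op x (u n)).
Proof.
split=> [ux i|h A /nbhs_bgP[i iA]].
  have /ux [m _ hm] : nbhs x [set y | bg_nbhs i (op x y)] by apply/nbhs_bgP; exists i.
  by exists m => n mn; exact: hm.
by have [m hm] := h i; exists m => // n mn; exact/iA/hm.
Qed.

Lemma bg_accessible :
  (forall x, x <> bg_one B -> exists i, ~ bg_nbhs i x) -> accessible_space G.
Proof.
move=> sep x y /eqP xy; have [|i ni] := sep (op x y).
  by move=> e; apply: xy; rewrite -[x]bg_op1r -(bg_opxx y) bg_opA e bg_op1.
have : nbhs x [set z | bg_nbhs i (op x z)] by apply/nbhs_bgP; exists i.
rewrite nbhsE => -[U [oU Ux] UV]; exists U; split=> //; first exact/mem_set.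
by apply/mem_set => Uy; exact: ni (UV _ Uy).
Qed.

Lemma bg_tychonoff (R : realType) :
  (forall x, x <> bg_one B -> exists i, ~ bg_nbhs i x) -> tychonoff_space G.
Proof.
by move=> sep; split; [exact: bg_accessible|exact: (uniform_completely_regular (R := R))].
Qed.

End boolean_group.

(** * Boolean groups of parity functions *)

Section parity_span.
Variables (X L : Type) (r : X -> L -> bool).

(** A list over [L] stands for a sum modulo 2, identified with its parity function on [X]; two
    choices of [r] give the two groups below. *)
Definition parity (l : seq L) (x : X) : bool := odd (count (r x) l).

Definition parity_span := {f : X -> bool | exists l, f = parity l}.

Lemma parity_cat l l' x : parity (l ++ l') x = parity l x (+) parity l' x.
Proof. by rewrite /parity count_cat oddD. Qed.

Definition psum (l : seq L) : parity_span := exist _ (parity l) (ex_intro _ l erefl).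

Lemma psumP (f : parity_span) : exists l, f = psum l.
Proof. by case: f => f [l fl]; exists l; exact: eq_exist. Qed.

Lemma parity_span_inj (f g : parity_span) : sval f =1 sval g -> f = g.
Proof. by case: f g => f ? [g ?] /= fg; apply: eq_exist; exact: funext. Qed.

Program Definition padd (f g : parity_span) : parity_span :=
  exist _ (fun x => sval f x (+) sval g x) _.
Next Obligation.
move=> [f [l fl]] [g [l' gl']]; exists (l ++ l').
by apply: funext => x; rewrite /= parity_cat -fl -gl'.
Qed.

Lemma psum_cat l l' : psum (l ++ l') = padd (psum l) (psum l').
Proof. by apply: parity_span_inj => x /=; rewrite parity_cat. Qed.

Lemma paddA : associative padd.
Proof. by move=> f g h; apply: parity_span_inj => x /=; rewrite addbA. Qed.

Lemma paddC : commutative padd.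
Proof. by move=> f g; apply: parity_span_inj => x /=; rewrite addbC. Qed.

Lemma padd0 : left_id (psum [::]) padd.
Proof. by move=> f; apply: parity_span_inj => x. Qed.

Lemma paddxx f : padd f f = psum [::].
Proof. by apply: parity_span_inj => x /=; rewrite addbb. Qed.

End parity_span.

(** * A Frechet group of weight omega_1 *)

Lemma all_InP (T : Type) (p : pred T) (s : seq T) :
  all p s <-> forall t, List.In t s -> p t.
Proof.
elim: s => [|x s IH] //=; split=> [/andP[px /IH ps] t [<-|/ps]//|h].
by apply/andP; split; [apply: h; left|apply/IH => t ts; apply: h; right].
Qed.

Lemma In_nth (T : Type) (x0 : T) (s : seq T) t :
  List.In t s -> exists i, nth x0 s i = t.
Proof.
by elim: s => [|x s IH] //= [<-|/IH[i <-]]; [exists 0|exists i.+1].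
Qed.

Lemma injective_unbounded (f : nat -> nat) : injective f ->
  forall m, exists k, (m <= f k)%N.
Proof.
move=> fi m; apply: contrapT => /forallNP h.
have lt (i : 'I_m.+1) : (f i < m)%N by rewrite ltnNge; apply/negP; exact: h.
have : injective (fun i : 'I_m.+1 => Ordinal (lt i)).
  by move=> i j [] /fi; exact: val_inj.
by move=> /leq_card; rewrite !card_ord ltnn.
Qed.

Section cp_group.
Variables (O : omega1) (A : O -> nat -> bool).
Hypothesis A_inj : injective A.

(* With respect to [prefix_of], [parity_span] is the group of clopen subsets of
   the range of [A] in the Cantor space, under symmetric difference. *)
Definition prefix_of (a : O) (t : seq bool) : bool := t == mkseq (A a) (size t).

Local Notation E := (parity_span prefix_of).

Let nbh (s : seq O) : set E := [set f | all (fun a => ~~ sval f a) s].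

Let nbh1 s : nbh s (psum _ [::]).
Proof. by apply/all_InP. Qed.

Let nbhM s : exists s', forall f g, nbh s' f -> nbh s' g -> nbh s (padd f g).
Proof.
exists s => f g /all_InP fs /all_InP gs; apply/all_InP => a ais /=.
by rewrite (negbTE (fs a ais)) gs.
Qed.

Let nbhI s s' : exists t, nbh t `<=` nbh s `&` nbh s'.
Proof. by exists (s ++ s') => f; rewrite /nbh /= all_cat => /andP. Qed.

Definition cp_base := @BooleanGroupBase E (@padd _ _ _) (psum _ [::])
  (@paddA _ _ _) (@paddC _ _ _) (@padd0 _ _ _) (@paddxx _ _ _)
  (seq O) [::] nbh nbh1 nbhM nbhI.

Definition cp_group := boolean_group cp_base.
HB.instance Definition _ := TopologicalGroup.on cp_group.

Lemma cp_tychonoff (R : realType) : tychonoff_space cp_group.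
Proof.
apply: (bg_tychonoff R) => f f0; apply: contrapT => /forallNP h; apply: f0.
apply: parity_span_inj => a; have /contrapT := h [:: a].
by rewrite /= /nbh /= andbT => /negbTE.
Qed.

(** The extra number in the code makes every element recur at arbitrarily large indices, so that
    nonempty sets of elements have infinite index sets. *)
Let enum (n : nat) : cp_group :=
  psum _ (odflt (0, [::]) (unpickle n : option (nat * seq (seq bool)))).2.

Let enum_surj (x : cp_group) m : exists2 n, (m <= n)%N & enum n = x.
Proof.
have [l xl] := psumP x.
have [|k hk] := @injective_unbounded (fun k => pickle (k, l)) _ m.
  by move=> i j /(pcan_inj pickleK) [].
by exists (pickle (k, l)) => //; rewrite /enum pickleK xl.
Qed.

Lemma cp_separable : separable_space cp_group.
Proof.
exists setT; last by move=> U [x Ux] oU; exists x.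
have -> : [set: cp_group] = enum @` [set: nat].
  by apply/seteqP; split=> // x _; have [n _ <-] := enum_surj x 0; exists n.
exact: (sub_countable (card_image_le _ _) (countableP _)).
Qed.

(** A prefix of [A g] long enough to differ from those of [A a], for all [a] in [s], gives the
    generator sought. *)
Lemma cp_separation (s : seq O) (g : O) : ~ List.In g s ->
  exists2 f : cp_group, nbh s f & sval f g.
Proof.
move=> gs; have [N hN] : exists N, forall a n, (N <= n)%N -> List.In a s ->
    mkseq (A a) n <> mkseq (A g) n.
  elim: s gs => [|a s IH] gs; first by exists 0.
  have [|N hN] := IH; first by move=> gs'; apply: gs; right.
  have [k hk] : exists k, A a k <> A g k.
    apply: contrapT => /forallNP h; apply: gs; left; apply: A_inj.
    by apply: funext => k; exact: contrapT (h k).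
  exists (maxn N k.+1) => b n; rewrite geq_max => /andP[Nn kn] [<-|]; last exact: hN.
  by move=> e; apply: hk; rewrite -(nth_mkseq false (A a) kn) e nth_mkseq.
exists (psum _ [:: mkseq (A g) N]).
  apply/all_InP => a ais; rewrite /= /parity /= addn0 /prefix_of size_mkseq.
  by case: eqP => // e; have := hN a N (leqnn _) ais; rewrite e.
by rewrite /= /parity /= addn0 /prefix_of size_mkseq eqxx.
Qed.

(** A metric would give countably many finite sets [s n] whose neighbourhoods form a base at the
    identity; a coordinate [c] outside all of them refutes this. *)
Lemma cp_not_metrizable (R : realType) : ~ metrizable_space R cp_group.
Proof.
move=> [M [f [g [fg gf cf cg]]]]; pose x0 : cp_group := bg_one cp_base.
have /choice[s hs] (n : nat) : exists s, forall y : cp_group, nbh s y ->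
    ball (f x0) (n.+1%:R^-1 : R) (f y).
  have : nbhs x0 (f @^-1` ball (f x0) (n.+1%:R^-1 : R)).
    by apply: cf; apply: nbhsx_ballx; rewrite invr_gt0 ltr0n.
  move=> /nbhs_bgP[s hs]; exists s => y sy; apply: hs.
  by rewrite bg_op1.
have [a0] := lt1_inh O.
(* [u] lists the entries of all the [s n], so [c] lies beyond each of them. *)
pose u k := if unpickle k is Some (n, i) then nth a0 (s n) i else a0.
have [c hc] := lt1_bound u.
have nc n : ~ List.In c (s n).
  move=> /(In_nth a0)[i e].
  by apply: (@lt1_irr O c); have := hc (pickle (n, i)); rewrite /u pickleK e.
have : nbhs (f x0) (g @^-1` [set y : cp_group | nbh [:: c] y]).
  apply: cg; rewrite fg; apply/nbhs_bgP; exists [:: c] => y.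
  by rewrite bg_op1.
move=> /nbhs_ballP[e e0 he].
have [n hn] : exists n : nat, (n.+1%:R^-1 < e :> R)%R.
  have := near_infty_natSinv_lt (PosNum e0); case=> n _ /(_ n (leqnn n)) h.
  by exists n.
have [y ys yc] := cp_separation (nc n).
have := he (f y) (le_ball (ltW hn) (hs n y ys)).
by rewrite /= fg /nbh /= yc.
Qed.

Hypothesis no_tower : forall (O : omega1) (T : O -> set nat), ~ maximal_tower T.

(** For [x] in the closure of [S], the finite intersections of the [V a] meet the index set of [S]
    in infinite sets; a pseudo-intersection lists a sequence in [S] that converges to [x]. *)
Lemma cp_frechet : frechet_space cp_group.
Proof.
move=> S x clS.
pose V a : set nat := [set n | ~~ sval (padd x (enum n)) a].
have [s m|P iP [PS PV]] :=
    @filter_pseudo_intersection no_tower O [set n | S (enum n)] V.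
  have : nbhs x [set y : cp_group | nbh s (padd x y)].
    by apply/nbhs_bgP; exists s.
  move=> /clS[y [Sy xy]]; have [n mn ny] := enum_surj y m.
  rewrite -{}ny in Sy xy; exists n => //; split=> // a ais.
  exact: (all_InP _ _).1 xy a ais.
have [u iu Pu] := infinite_subseq iP.
exists (fun k => enum (u k)); first by move=> k; exact: PS.
apply/bg_cvgP; elim=> [|a s [m hm]]; first by exists 0.
have [p hp] := PV a; exists (maxn m p) => n; rewrite geq_max => /andP[mn pn].
rewrite /= /nbh /=; apply/andP; split; last exact: hm.
by apply: hp => //; exact: leq_trans pn (increasing_ge iu n).
Qed.

End cp_group.

Lemma maximal_tower_exists (R : realType) :
  ~ (exists G : topologicalGroupType,
       [/\ tychonoff_space G, separable_space G, frechet_space G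
         & ~ metrizable_space R G]) ->
  exists (O : omega1) (T : O -> set nat), maximal_tower T.
Proof.
move=> noG; apply: contrapT => nT; apply: noG.
have no_tower (O : omega1) (T : O -> set nat) : ~ maximal_tower T.
  by move=> mT; apply: nT; exists O, T.
have [W [A Ai]] := omega1_cantor.
exists (cp_group A); split.
- exact: cp_tychonoff R.
- exact: cp_separable.
- exact: cp_frechet.
- exact: cp_not_metrizable.
Qed.

(** * The Franklin-Rajagopalan space of a maximal tower *)

Section tower_space.
Variables (O : omega1) (T : O -> set nat).
Hypothesis mT : maximal_tower T.

Definition tower_space : Type := nat + O.
Local Notation X := tower_space.

(* The sets [subbasic j] and their complements generate the topology of the
   space; only its convergent sequences are used. *)
Definition subbasic (j : X) : set X :=
  match j with
  | inl n => [set x | x = inl n]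
  | inr a => [set x | match x with inl n => T a n | inr b => ~ lt1 a b end]
  end.

Definition conv (u : nat -> X) (x : X) :=
  forall j, exists m, forall k, m <= k -> (subbasic j (u k) <-> subbasic j x).

Lemma conv_subseq u x phi : increasing phi -> conv u x -> conv (u \o phi) x.
Proof.
move=> ip ux j; have [m hm] := ux j; exists m => k mk; apply: hm.
exact: leq_trans mk (increasing_ge ip k).
Qed.

Lemma conv_cst x : conv (fun=> x) x.
Proof. by move=> j; exists 0. Qed.

Lemma conv_subbasic u x j : conv u x -> (forall k, subbasic j (u k)) -> subbasic j x.
Proof. by move=> /(_ j)[m hm] uj; apply/(hm m (leqnn m)). Qed.

Lemma conv_not_subbasic u x j :
  conv u x -> (forall k, ~ subbasic j (u k)) -> ~ subbasic j x.
Proof. by move=> /(_ j)[m hm] uj /(hm m (leqnn m)); exact: uj. Qed.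

(** Within [subbasic (inr a)] countably many subbasic sets separate points, which allows diagonal
    arguments. *)
Lemma subbasic_separates (a : O) (x y : X) :
  subbasic (inr a) x -> subbasic (inr a) y ->
  (forall n, subbasic (inl n) x <-> subbasic (inl n) y) ->
  (forall b, ~ lt1 a b -> (subbasic (inr b) x <-> subbasic (inr b) y)) -> x = y.
Proof.
case: x y => [n|b] [m|c] //= ax ay hn hb.
- by apply/esym/(hn n).
- by have /hn := erefl (inl n : X).
- by have /hn := erefl (inl m : X).
- congr inr; have := (hb b ax).1 (@lt1_irr _ b); have := (hb c ay).2 (@lt1_irr _ c).
  by case: (lt1_total b c).
Qed.

Lemma conv_cst_eq x y : conv (fun=> x) y -> x = y.
Proof.
move=> xy; have h j : subbasic j x <-> subbasic j y.
  by have [m /(_ m (leqnn m))] := xy j.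
case: x y h {xy} => [n|b] [m|c] h.
- by apply/esym/(h (inl n)).
- by have /(h (inl n)) := erefl (inl n : X).
- by have /(h (inl m)) := erefl (inl m : X).
- congr inr; have := (h (inr b)).1 (@lt1_irr _ b).
  have := (h (inr c)).2 (@lt1_irr _ c).
  by rewrite /=; case: (lt1_total b c).
Qed.

(** The positions whose value is minimal in the tail that starts there are infinite in number. *)
Lemma nondecreasing_subseq (v : nat -> O) : exists2 phi, increasing phi &
  forall i j, i <= j -> ~ lt1 (v (phi j)) (v (phi i)).
Proof.
pose K k := forall l, k <= l -> ~ lt1 (v l) (v k).
have [|phi ip hp] := @infinite_subseq K.
  move=> m; have [|a [k mk <-] hk] := @lt1_min O (fun a => exists2 k, m <= k & v k = a).
    by exists (v m); exists m.
  by exists k => // l kl lk; apply: (hk _ lk); exists l => //; exact: leq_trans kl.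
by exists phi => // i j ij; apply: hp; exact: increasing_leq.
Qed.

Lemma conv_seq_compact_idx (v : nat -> O) :
  exists2 phi, increasing phi & exists x, conv (fun k => inr (v (phi k))) x.
Proof.
have [phi ip hp] := nondecreasing_subseq v; exists phi => //.
(* The limit is the supremum [d] of the nondecreasing subsequence. *)
have [|d dub dmin] := @lt1_min O (fun d => forall k, ~ lt1 d (v (phi k))).
  by have [g hg] := lt1_bound (v \o phi); exists g => k; apply: lt1_asym; exact: hg.
exists (inr d) => -[n|a]; first by exists 0.
case: (pselect (lt1 a d)) => [ad|nad].
  have /existsNP[k0 /contrapT ak0] := dmin a ad.
  exists k0 => k k0k; split=> // + _.
  by move/nlt1P => [ka|ka]; apply: (hp _ _ k0k); [exact: lt1_trans ak0|rewrite ka].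
exists 0 => k _; split=> // _ /=.
exact: nlt1_trans nad (dub k).
Qed.

(** If no value recurs infinitely often, let [a] be least such that [T a] meets the range infinitely
    often; it exists by maximality. A subsequence inside [T a] is almost disjoint from the earlier
    [T b] and almost inside the later ones, so it converges to [a]. *)
Lemma conv_seq_compact_nat (v : nat -> nat) :
  exists2 phi, increasing phi & exists x, conv (fun k => inl (v (phi k))) x.
Proof.
case: (pselect (exists n, infinite_nat [set k | v k = n])).
  move=> [n /infinite_subseq[phi ip hp]]; exists phi => //; exists (inl n).
  by move=> j; exists 0 => k _; rewrite hp.
move=> /forallNP fin.
have vinf m : exists p, forall k, p <= k -> m <= v k.
  elim: m => [|m [p hp]]; first by exists 0.
  have /not_infinite_natP[q hq] := fin m; exists (maxn p q) => k.
  rewrite geq_max => /andP[pk qk]; rewrite ltn_neqAle hp // andbT.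
  by apply/eqP => e; apply: (hq k qk).
have iv : infinite_nat (range v).
  by move=> m; have [p hp] := vinf m; exists (v p); [exact: hp|exists p].
have [a iva amin] := lt1_min (tower_maximal mT iv).
have iK : infinite_nat [set k | T a (v k)].
  move=> p; have [n pn [[k _ kn] Tn]] := iva (\max_(i < p) v i).+1.
  exists k; last by rewrite /= kn.
  rewrite leqNgt; apply/negP => kp; move: pn; rewrite -kn ltnNge => /negP; apply.
  exact: (leq_bigmax (Ordinal kp)).
have [phi ip hp] := infinite_subseq iK; exists phi => //; exists (inr a).
have phiinf m : exists p, forall k, p <= k -> m <= v (phi k).
  have [p h] := vinf m; exists p => k pk; apply: h.
  exact: leq_trans pk (increasing_ge ip k).
case=> [n|b].
  have [p h] := phiinf n.+1; exists p => k /h nv; split=> // -[e].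
  by move: nv; rewrite e ltnn.
case: (lt1_total b a) => [ba|->|ab].
- have /not_infinite_natP[q hq] := amin b ba.
  have [p h] := phiinf q; exists p => k /h qv; split=> //= Tb; exfalso.
  by apply: (hq _ qv); split=> //; exists (phi k).
- exists 0 => k _; split=> /= _; [exact: lt1_irr|exact: hp].
- have [q hq] := tower_sub mT ab.
  have [p h] := phiinf q; exists p => k /h qv; split=> /= _; first exact: lt1_asym.
  by apply: hq => //; exact: hp.
Qed.

Lemma conv_seq_compact (u : nat -> X) :
  exists2 phi, increasing phi & exists x, conv (u \o phi) x.
Proof.
have step (I : Type) (f : I -> X) (i0 : I) :
    (forall v : nat -> I, exists2 phi, increasing phi &
       exists x, conv (fun k => f (v (phi k))) x) ->
    infinite_nat [set k | exists i, u k = f i] ->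
    exists2 phi, increasing phi & exists x, conv (u \o phi) x.
  move=> hf /infinite_subseq[psi ips /choice[v hv]].
  have [phi ip [x hx]] := hf v; exists (psi \o phi); first exact: increasing_comp.
  exists x; have -> // : u \o (psi \o phi) = fun k => f (v (phi k)).
  by apply: funext => k; rewrite /= hv.
have [a0] := lt1_inh O.
case: (pselect (infinite_nat [set k | exists b, u k = inr b])).
  exact: step a0 conv_seq_compact_idx.
move=> fin; apply: step 0 conv_seq_compact_nat _.
have /not_infinite_natP[m hm] := fin => p; exists (maxn m p); first exact: leq_maxr.
have := hm _ (leq_maxl m p); rewrite /=; case: (u _) => [n _|b h]; first by exists n.
by exfalso; apply: h; exists b.
Qed.

(** The [b n] are interleaved with the [a n], whose supremum is [d], so they increase to [d] as
    well. *)
Lemma conv_interleave (a b : nat -> O) (d : O) :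
  (forall n, lt1 (a n) (b n)) -> (forall n, lt1 (b n) (a n.+1)) ->
  (forall n, ~ lt1 d (a n)) ->
  (forall c, lt1 c d -> exists n, lt1 c (a n)) ->
  conv (fun n => inr (b n)) (inr d).
Proof.
move=> ab ba da dmin [n|c]; first by exists 0.
case: (pselect (lt1 c d)) => [cd|ncd].
  have [n0 cn0] := dmin c cd; exists n0 => k n0k; split=> // /= + _; apply.
  apply: lt1_trans (ab k); elim: k n0k => [|k IH].
    by rewrite leqn0 => /eqP <-.
  rewrite leq_eqVlt => /predU1P[<-//|/IH ck].
  exact: lt1_trans (lt1_trans ck (ab k)) (ba k).
exists 0 => k _; split=> //= _ cb.
have := lt1_trans cb (ba k).
exact: nlt1_trans ncd (da _).
Qed.

(* [agree s] is the equivalence relation of a finite clopen partition, and every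
   finite clopen partition is refined by one of this form. *)
Definition agree (s : seq X) (x y : X) :=
  forall j, List.In j s -> (subbasic j x <-> subbasic j y).

Lemma conv_agree s u x : conv u x -> exists m, forall k, m <= k -> agree s (u k) x.
Proof.
move=> ux; elim: s => [|j s [m hm]]; first by exists 0.
have [p hp] := ux j; exists (maxn m p) => k; rewrite geq_max => /andP[mk pk] i.
by move=> [<-|]; [exact: hp|exact: hm].
Qed.

(** * Sequentially closed relations off the diagonal *)

Section neighbourhood_of_diagonal.
Variable Z : X -> X -> Prop.
Hypothesis Zclosed : forall u v x y, conv u x -> conv v y ->
  (forall k, Z (u k) (v k)) -> Z x y.
Hypothesis Zirr : forall x, ~ Z x x.

Let Zsubseq (u v : nat -> X) : (forall k, Z (u k) (v k)) ->
  exists phi x y, [/\ increasing phi, conv (u \o phi) x, conv (v \o phi) y & Z x y].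
Proof.
move=> Zuv; have [phi ip [x ux]] := conv_seq_compact u.
have [psi ips [y vy]] := conv_seq_compact (v \o phi).
exists (phi \o psi), x, y; split=> //; first exact: increasing_comp.
  exact: (conv_subseq ips ux).
by apply: (Zclosed (conv_subseq ips ux) vy) => k; exact: Zuv.
Qed.

(* The pressing-down argument: otherwise a pair of interleaved sequences of
   indices in [Z] would have a common limit. *)
Let Zbounded : exists a N, forall x y, Z x y ->
  ~ subbasic (inr a) x -> ~ subbasic (inr a) y ->
  ~ ((forall n, n < N -> x <> inl n) /\ (forall n, n < N -> y <> inl n)).
Proof.
apply: contrapT => nb.
have far a N : exists xy, [/\ Z xy.1 xy.2, ~ subbasic (inr a) xy.1,
    ~ subbasic (inr a) xy.2, forall n, n < N -> xy.1 <> inl n &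
    forall n, n < N -> xy.2 <> inl n].
  apply: contrapT => nf; apply: nb; exists a, N => x y Zxy ax ay [xN yN].
  by apply: nf; exists (x, y).
(* For fixed [a] let [N] grow: a limit pair avoids every natural number, hence consists of indices
   beyond [a]. *)
have idx a : exists bc, [/\ lt1 a bc.1, lt1 a bc.2 & Z (inr bc.1) (inr bc.2)].
  have /choice[w hw] := far a.
  have [|phi [x [y [ip ux vy Zxy]]]] := @Zsubseq (fun k => (w k).1) (fun k => (w k).2).
    by move=> k; case: (hw k).
  have nx : ~ subbasic (inr a) x.
    by apply: conv_not_subbasic ux _ => k; case: (hw (phi k)).
  have ny : ~ subbasic (inr a) y.
    by apply: conv_not_subbasic vy _ => k; case: (hw (phi k)).
  have big n k : n < k -> n < phi k.
    by move=> nk; exact: leq_trans nk (increasing_ge ip k).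
  case: x nx ux Zxy => [n|b] nx ux Zxy.
    have [m hm] := ux (inl n).
    have [_ _ _ h _] := hw (phi (maxn m n.+1)).
    by case: (h n (big _ _ (leq_maxr _ _))); apply/(hm _ (leq_maxl _ _)).
  case: y ny vy Zxy => [n|c] ny vy Zxy.
    have [m hm] := vy (inl n).
    have [_ _ _ _ h] := hw (phi (maxn m n.+1)).
    by case: (h n (big _ _ (leq_maxr _ _))); apply/(hm _ (leq_maxl _ _)).
  by exists (b, c); split=> //; exact: contrapT.
have /choice[w hw] := idx.
have /choice[g hg] (a : O) : exists g, lt1 (w a).1 g /\ lt1 (w a).2 g.
  have [g h] := lt1_bound (fun n => if n is 0 then (w a).1 else (w a).2).
  by exists g; split; [exact: (h 0)|exact: (h 1)].
(* Each step climbs past both coordinates of [w (a n)], so both coordinate sequences converge to the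
   supremum [d]. *)
have [a0] := lt1_inh O; pose a n := iter n g a0.
have [|d dub dmin] := @lt1_min O (fun d => forall n, ~ lt1 d (a n)).
  by have [h hh] := lt1_bound a; exists h => k; apply: lt1_asym; exact: hh.
have dmin' c : lt1 c d -> exists n, lt1 c (a n).
  by move=> /dmin /existsNP[n /contrapT]; exists n.
apply: (@Zirr (inr d)).
apply: (@Zclosed (fun n => inr (w (a n)).1) (fun n => inr (w (a n)).2)).
- apply: conv_interleave dub dmin' => n; first by case: (hw (a n)).
  by case: (hg (a n)).
- apply: conv_interleave dub dmin' => n; first by case: (hw (a n)).
  by case: (hg (a n)).
- by move=> n; case: (hw (a n)).
Qed.

(** By [Zbounded], pairs in [Z] that agree on [inr a] and on all [n < N] lie in [subbasic (inr a)].
    If longer and longer lists failed there, a limit pair would be both in [Z] and on the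
    diagonal. *)
Lemma agree_separates : exists s, forall x y, agree s x y -> ~ Z x y.
Proof.
have [a [N aN]] := Zbounded; have [e he] := lt1_enum a.
apply: contrapT => /forallNP ns.
pose s k : seq X := inr a :: [seq inl n | n <- iota 0 (k + N)] ++
                    [seq inr (e n) | n <- iota 0 k].
have sl k n : n < k + N -> List.In (inl n : X) (s k).
  move=> nk; right; apply/List.in_or_app; left; apply: List.in_map.
  suff : forall i p, i <= n < i + p -> List.In n (iota i p) by apply.
  move=> i p; elim: p i => [|p IH] i; first by lia.
  move=> h /=; case: (eqVneq i n) => [|ne]; first by left.
  by right; apply: IH; lia.
have sr k n : n < k -> List.In (inr (e n) : X) (s k).
  move=> nk; right; apply/List.in_or_app; right.
  apply: (List.in_map (fun n => inr (e n) : X)).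
  suff : forall i p, i <= n < i + p -> List.In n (iota i p) by apply.
  move=> i p; elim: p i => [|p IH] i; first by lia.
  move=> h /=; case: (eqVneq i n) => [|ne]; first by left.
  by right; apply: IH; lia.
have /choice[w hw] k : exists xy, agree (s k) xy.1 xy.2 /\ Z xy.1 xy.2.
  have /existsNP[x /existsNP[y /not_implyP[xy /contrapT Zxy]]] := ns (s k).
  by exists (x, y).
(* If one coordinate were [inl n], agreement on this singleton would make the other equal to it,
   against [Zirr]. *)
have inN k n : n < N -> (w k).1 <> inl n /\ (w k).2 <> inl n.
  move=> nN; have [ag Zw] := hw k.
  have agn := ag (inl n) (sl k n (leq_trans nN (leq_addl _ _))).
  by split=> en; move: (agn); rewrite /= en;
     [move=> /(fun h => h.1 erefl)|move=> /(fun h => h.2 erefl)] => en';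
     move: Zw; rewrite en en'; exact: Zirr.
have ina k : subbasic (inr a) (w k).1 /\ subbasic (inr a) (w k).2.
  have [ag Zw] := hw k; have aga := ag (inr a) (or_introl erefl).
  case: (pselect (subbasic (inr a) (w k).1)) => h; first by split=> //; apply/aga.
  exfalso; apply: (aN _ _ Zw h); first by move/aga.
  by split=> n nN; case: (inN k n nN).
have [|phi [x [y [ip ux vy Zxy]]]] := @Zsubseq (fun k => (w k).1) (fun k => (w k).2).
  by move=> k; case: (hw k).
have lim j : (exists k0, forall k, k0 <= k -> List.In j (s k)) ->
    (subbasic j x <-> subbasic j y).
  move=> [k0 hk0]; have [m hm] := ux j; have [p hp] := vy j.
  pose k := maxn k0 (maxn m p).
  have mk : m <= k by rewrite !leq_max leqnn orbT.
  have pk : p <= k by rewrite !leq_max leqnn !orbT.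
  have kk : k0 <= phi k.
    by apply: leq_trans (increasing_ge ip k); rewrite leq_max leqnn.
  have [/(_ j (hk0 _ kk)) ag _] := hw (phi k).
  by rewrite -(hm k mk) -(hp k pk).
suff xy : x = y by move: Zxy; rewrite xy; exact: Zirr.
apply: (@subbasic_separates a).
- by apply: conv_subbasic ux _ => k; case: (ina (phi k)).
- by apply: conv_subbasic vy _ => k; case: (ina (phi k)).
- by move=> n; apply: lim; exists n.+1 => k nk; apply: sl; exact: leq_trans (leq_addr _ _).
- by move=> b /he[n <-]; apply: lim; exists n.+1 => k nk; exact: sr.
Qed.

End neighbourhood_of_diagonal.

(** Each index [a] except the least is a limit of numbers in [T a] that avoid more and more of the
    earlier members of the tower. *)
Lemma tower_space_separable : exists d : nat -> X, forall x,
  exists u : nat -> nat, conv (d \o u) x.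
Proof.
have [|a0 _ a0min] := @lt1_min O (fun=> True).
  by have [a] := lt1_inh O; exists a.
(* [T a0] may be finite, so the least index is listed along with the numbers, which are shifted by
   one. *)
exists (fun n => if n is n'.+1 then inl n' else inr a0) => -[n|a].
  by exists (fun=> n.+1); exact: conv_cst.
case: (pselect (exists b, lt1 b a)) => [[b0 b0a]|nb]; last first.
  exists (fun=> 0); have -> : a = a0; last exact: conv_cst.
  case: (lt1_total a a0) => // h; first by have := a0min a h.
  by exfalso; apply: nb; exists a0.
have [e he] := lt1_enum a.
(* Finitely many earlier members are almost contained in one [T b] with [b] before [a]; strictness
   then leaves infinitely many numbers of [T a] outside them. *)
have hb m : exists2 b, lt1 b a & forall j, j < m -> lt1 (e j) a ->
    almost_sub (T (e j)) (T b).
  elim: m => [|m [b ba hb]]; first by exists b0.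
  case: (pselect (lt1 (e m) a)) => [ema|nema]; last first.
    exists b => // j; rewrite ltnS leq_eqVlt => /predU1P[->//|]; exact: hb.
  case: (lt1_total b (e m)) => h.
  - exists (e m) => // j; rewrite ltnS leq_eqVlt => /predU1P[-> _|jm ja].
      exact: almost_subW.
    by apply: almost_sub_trans (hb j jm ja) _; exact: tower_sub.
  - exists b => // j; rewrite ltnS leq_eqVlt => /predU1P[-> _|]; last exact: hb.
    by rewrite h; exact: almost_subW.
  - exists b => // j; rewrite ltnS leq_eqVlt => /predU1P[-> _|]; last exact: hb.
    exact: tower_sub.
have hn m : exists2 n, m <= n & T a n /\ forall j, j < m -> lt1 (e j) a -> ~ T (e j) n.
  have [b ba h] := hb m.
  have [p hp] : exists p, forall n, p <= n -> forall j, j < m -> lt1 (e j) a ->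
      T (e j) n -> T b n.
    elim: {-2}m (leqnn m) => [|q IH] qm; first by exists 0.
    have [p hp] := IH (ltnW qm).
    case: (pselect (lt1 (e q) a)) => [eqa|neqa]; last first.
      exists p => n pn j; rewrite ltnS leq_eqVlt => /predU1P[->//|]; exact: hp.
    have [r hr] := h q qm eqa; exists (maxn p r) => n.
    rewrite geq_max => /andP[pn rn] j; rewrite ltnS leq_eqVlt => /predU1P[-> _|].
      exact: hr.
    exact: hp.
  have [n] := tower_strict mT ba (maxn m p); rewrite geq_max => /andP[mn pn] [Ta nTb].
  by exists n => //; split=> // j jm ja /(hp n pn j jm ja).
have /choice[u hu] : forall m, exists n, m <= n /\
    (T a n /\ forall j, j < m -> lt1 (e j) a -> ~ T (e j) n).
  by move=> m; have [n] := hn m; exists n.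
exists (fun m => (u m).+1) => -[n|b].
  exists n.+1 => k nk; split=> //= -[kn]; have [ku _] := hu k.
  by move: (leq_trans nk ku); rewrite kn ltnn.
case: (lt1_total b a) => [ba|->|ab].
- have [|j je] := he b; first exact: lt1_asym.
  exists j.+1 => k jk; split=> //= Tb; have [_ [_ h]] := hu k; exfalso.
  by apply: (h j jk); rewrite je.
- by exists 0 => k _; split=> /= _; [exact: lt1_irr|have [_ []] := hu k].
- have [m hm] := tower_sub mT ab; exists m => k mk; split=> /= _.
    exact: lt1_asym.
  by have [ku [Ta _]] := hu k; apply: hm => //; exact: leq_trans ku.
Qed.

(** An index above all those in [s] works; this is the non-compactness of the space. *)
Lemma subbasic_no_finite_cover (s : seq X) :
  exists x, forall j, List.In j s -> ~ subbasic j x.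
Proof.
have [a0] := lt1_inh O.
have [g hg] := lt1_bound_seq (fun j : X => if j is inr a then a else a0) s.
by exists (inr g) => -[n|a] // /hg /= ag; apply.
Qed.

Lemma subbasic_self j : subbasic j j.
Proof. by case: j => //= a; exact: lt1_irr. Qed.

End tower_space.

(** * The free Boolean group of the tower space *)

Section bg_sequences.
Variable B : boolean_group_base.
Local Notation G := (boolean_group B).
Local Notation op := (@bg_op B).

Lemma bg_cvgM (u v : nat -> G) (x y : G) : u @ \oo --> x -> v @ \oo --> y ->
  (fun k => op (u k) (v k) : G) @ \oo --> (op x y : G).
Proof.
move=> /bg_cvgP ux /bg_cvgP vy; apply/bg_cvgP => i.
have [j hj] := bg_nbhsM i; have [m hm] := ux j; have [p hp] := vy j.
exists (maxn m p) => n; rewrite geq_max => /andP[mn pn].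
by rewrite bg_op_cancel; apply: hj; [exact: hm|exact: hp].
Qed.

Lemma bg_cvg_subseq (u : nat -> G) (x : G) phi : increasing phi ->
  u @ \oo --> x -> (u \o phi) @ \oo --> x.
Proof.
move=> ip /bg_cvgP ux; apply/bg_cvgP => i; have [m hm] := ux i; exists m => n mn.
by apply: hm; exact: leq_trans mn (increasing_ge ip n).
Qed.

Lemma bg_cvg_unique (u : nat -> G) (x y : G) :
  (forall x, x <> bg_one B -> exists i, ~ bg_nbhs i x) ->
  u @ \oo --> x -> u @ \oo --> y -> x = y.
Proof.
move=> sep /bg_cvgP ux /bg_cvgP uy; apply: contrapT => xy.
have [|i ni] := sep (op x y).
  by move=> e; apply: xy; rewrite -[x]bg_op1r -(bg_opxx y) bg_opA e bg_op1.
have [j hj] := bg_nbhsM i; have [m hm] := ux j; have [p hp] := uy j.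
pose n := maxn m p; apply: ni.
have -> : op x y = op (op x (u n)) (op y (u n)).
  by rewrite bg_op_cancel bg_opxx bg_op1r.
by apply: hj; [apply: hm; exact: leq_maxl|apply: hp; exact: leq_maxr].
Qed.

Definition sequentially_compact (W : set G) := forall u : nat -> G,
  (forall k, W (u k)) ->
  exists2 phi, increasing phi & exists2 x, W x & (u \o phi) @ \oo --> x.

Lemma sequentially_compact_countably_compact (W : set G) :
  sequentially_compact W -> countably_compact W.
Proof.
move=> scW U oU WU; apply: contrapT => nfin.
have /choice[x hx] N : exists x, W x /\ forall i, (i < N)%N -> ~ U i x.
  apply: contrapT => /forallNP nx; apply: nfin; exists [fset i in iota 0 N]%fset.
    by move=> i _; exact/mem_set.
  move=> x Wx; have /not_andP[//|/existsNP[i /not_implyP[iN /contrapT Uix]]] := nx x.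
  by exists i => //=; rewrite inE mem_iota.
have [|phi ip [y Wy xy]] := scW x; first by move=> k; case: (hx k).
have [i _ Uiy] := WU y Wy.
have /xy[m _ hm] : nbhs y (U i) by exact: open_nbhs_nbhs.
pose k := maxn m i.+1; have [_ h] := hx (phi k).
apply: (h i); last by apply: hm; exact: leq_maxl.
exact: leq_trans (leq_maxr m i.+1) (increasing_ge ip k).
Qed.

End bg_sequences.

(** Equal elements are removed two at a time. *)
Lemma even_count (T : eqType) (P : pred T) (l : seq T) :
  (forall x, ~~ odd (count_mem x l)) -> ~~ odd (count P l).
Proof.
have [n] := ubnP (size l); elim: n l => // n IH [|a l] //= ln ev.
have al : a \in l.
  by have := ev a; rewrite eqxx /= negbK -has_pred1 has_count; case: (count _ _).
have pl := perm_to_rem al.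
have cl Q : count Q l = (Q a + count Q (rem a l))%N by rewrite (permP pl Q).
rewrite cl addnA addnn oddD odd_double /=; apply: IH => [|x].
  move: ln; rewrite size_rem //; case: l al {ev pl cl} => //= b l _.
  by rewrite ltnS => /ltnW.
by have := ev x; rewrite cl addnA addnn oddD odd_double.
Qed.

HB.instance Definition _ (O : omega1) := gen_eqMixin (tower_space O).

Section free_group.
Variables (O : omega1) (T : O -> set nat).
Hypothesis mT : maximal_tower T.
Local Notation X := (tower_space O).
Local Notation conv := (@conv O T).
Local Notation agree := (@agree O T).

(* Finite subsets of [X] are represented by their indicator functions. *)
Definition same_point (x y : X) : bool := y == x.
Local Notation E := (parity_span same_point).
Local Notation psum := (@psum X X same_point).

Definition add_edge (W : set E) (s : seq X) : set E :=
  [set f | exists w x y, [/\ W w, agree s x y & f = padd w (psum [:: x; y])]].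

Fixpoint edge_sums (s : nat -> seq X) (n : nat) : set E :=
  if n is n'.+1 then add_edge (edge_sums s n') (s n') else [set psum [::]].

Lemma agree_sub s s' x y :
  (forall j, List.In j s -> List.In j s') -> agree s' x y -> agree s x y.
Proof. by move=> ss' h j /ss'; exact: h. Qed.

Lemma psum_pair x : psum [:: x; x] = psum [::].
Proof. by rewrite (psum_cat _ [:: x] [:: x]) paddxx. Qed.

Lemma padd0r (f : E) : padd f (psum [::]) = f.
Proof. by rewrite paddC padd0. Qed.

Lemma edge_sumsS s n : edge_sums s n `<=` edge_sums s n.+1.
Proof.
by move=> f sf; exists f, (inl 0), (inl 0); split=> //; rewrite psum_pair padd0r.
Qed.

Lemma edge_sums_le s n m : (n <= m)%N -> edge_sums s n `<=` edge_sums s m.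
Proof.
elim: m => [|m IH]; first by rewrite leqn0 => /eqP->.
by rewrite leq_eqVlt => /predU1P[->//|/IH h]; exact: subset_trans h (@edge_sumsS s m).
Qed.

Lemma edge_sums_sub s s' n :
  (forall i j, List.In j (s i) -> List.In j (s' i)) ->
  edge_sums s' n `<=` edge_sums s n.
Proof.
move=> ss'; elim: n => [|n IH] //= f [w [x [y [/IH sw xy ->]]]].
by exists w, x, y; split=> //; exact: agree_sub (ss' n) xy.
Qed.

Let nbh (s : nat -> seq X) : set E := [set f | exists n, edge_sums s n f].

Let nbh1 s : nbh s (psum [::]). Proof. by exists 0. Qed.

(** An edge that respects both [s i.*2] and [s i.*2.+1] may be used at either place, so two sums of
    [N] edges interleave into one of [N.*2] edges. *)
Let nbhM s : exists s', forall f g, nbh s' f -> nbh s' g -> nbh s (padd f g).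
Proof.
exists (fun i => s i.*2 ++ s i.*2.+1) => f g [n sf] [m sg].
exists (maxn n m).*2.
move: (edge_sums_le (leq_maxl n m) sf) (edge_sums_le (leq_maxr n m) sg).
elim: (maxn n m) f g {sf sg} => [|N IH] f g /=.
  by move=> -> ->; rewrite padd0.
move=> [w [x [y [sw xy ->]]]] [w' [x' [y' [sw' xy' ->]]]].
exists (padd (padd w w') (psum [:: x; y])), x', y'; split.
- exists (padd w w'), x, y; split=> //; first exact: IH.
  by apply: (agree_sub _ xy) => j js; apply/List.in_or_app; left.
- by apply: (agree_sub _ xy') => j js; apply/List.in_or_app; right.
- by rewrite -!paddA; congr padd; rewrite !paddA (paddC (psum _) w').
Qed.

Let nbhI s s' : exists t, nbh t `<=` nbh s `&` nbh s'.
Proof.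
exists (fun i => s i ++ s' i) => f [n tf]; split; exists n;
  apply: edge_sums_sub tf => i j ji; apply/List.in_or_app; by [left|right].
Qed.

Definition free_base := @BooleanGroupBase E (@padd _ _ _) (psum [::])
  (@paddA _ _ _) (@paddC _ _ _) (@padd0 _ _ _) (@paddxx _ _ _)
  (nat -> seq X) (fun=> [::]) nbh nbh1 nbhM nbhI.

Definition free_group := boolean_group free_base.
HB.instance Definition _ := TopologicalGroup.on free_group.
HB.instance Definition _ := PointedTopological.on free_group.
Local Notation G := free_group.

Definition gen (x : X) : G := psum [:: x].

(** The sets [K_n]. Repeated entries cancel, so sums of [n - 2] generators also occur when [n] is at
    least 2. *)
Definition words (n : nat) : set G := [set f | exists2 l, size l = n & f = psum l].

Lemma words_padd n m (f g : G) : words n f -> words m g -> words (n + m) (padd f g).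
Proof.
move=> [l ln ->] [l' lm ->]; exists (l ++ l'); first by rewrite size_cat ln lm.
by rewrite psum_cat.
Qed.

Lemma words_ex (f : G) : exists n, words n f.
Proof. by have [l fl] := psumP f; exists (size l), l. Qed.

Lemma psum2 x y : psum [:: x; y] = padd (gen x) (gen y).
Proof. exact: (psum_cat _ [:: x] [:: y]). Qed.

Lemma cvg_gen u x : conv u x -> (fun k => gen (u k)) @ \oo --> gen x.
Proof.
move=> ux; apply/bg_cvgP => s; have [m hm] := conv_agree (s 0) ux.
exists m => k mk; exists 1; exists (psum [::]), x, (u k); split=> //.
  by move=> j js; have := hm k mk j js; tauto.
by rewrite padd0 psum2.
Qed.

(* Some cell of a finite clopen partition meets the support of [f] in exactly
   one point, whereas it meets sums of edges evenly. *)
Lemma nontrivial_avoids_nbhs (f : G) :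
  f <> psum [::] -> exists s : nat -> seq X, ~ nbh s f.
Proof.
move=> f0; have [l fl] := psumP f.
have [x0 lx0] : exists x0, parity same_point l x0.
  apply: contrapT => /forallNP h; apply: f0; rewrite fl; apply: parity_span_inj => x.
  by apply/negbTE/negP; exact: h.
(* A partition that avoids [Z] has a cell containing [x0] and no other entry of [l]. *)
pose Z x y := x = x0 /\ y \in [seq y <- l | y != x0].
have [|x [e]|s hs] := @agree_separates O T mT Z.
- move=> u v x y ux vy uv; split.
    have uE : u = fun=> x0 by apply: funext => k; case: (uv k).
    by apply/esym/(@conv_cst_eq O T); rewrite -uE.
  have {uv} vl k : v k \in [seq y <- l | y != x0] by case: (uv k).
  apply: contrapT => /negP yl.
  suff [m hm] : exists m, forall k, (m <= k)%N -> v k \notin [seq y <- l | y != x0].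
    by have := hm m (leqnn m); rewrite vl.
  elim: [seq y <- l | y != x0] yl => [|b t IH]; first by exists 0.
  rewrite inE negb_or => /andP[/eqP yb /IH[m hm]].
  have [j hj] : exists j, ~ (subbasic T j b <-> subbasic T j y).
    apply: contrapT => /forallNP h; apply/yb/esym/(@conv_cst_eq O T) => j.
    by exists 0 => k _; exact: contrapT (h j).
  have [p hp] := vy j; exists (maxn m p) => k; rewrite geq_max => /andP[mk pk].
  rewrite inE negb_or hm // andbT; apply/eqP => vb; apply: hj.
  by rewrite -vb; exact: hp.
- by rewrite mem_filter e eqxx.
exists (fun=> s) => -[n].
pose P (y : X) := `[< agree s x0 y >].
have evW : edge_sums (fun=> s) n `<=`
    [set g | exists2 w, g = psum w & ~~ odd (count P w)].
  elim: n => [|n IH] g /=; first by move=> ->; exists [::].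
  move=> [_ [x [y [/IH[w -> ew] xy ->]]]]; exists (w ++ [:: x; y]).
    by rewrite psum_cat.
  rewrite count_cat /= addn0 oddD (negbTE ew) oddD.
  have -> : P x = P y.
    by apply/asboolP/asboolP => h j js; have := h j js; have := xy j js; tauto.
  by rewrite addbb.
move=> /evW[w fw ew].
(* [w] and [l] represent the same element, so all multiplicities in [w ++ l] are even. *)
have : ~~ odd (count P (w ++ l)).
  apply: even_count => x; rewrite count_cat oddD.
  have := congr1 (fun g : E => sval g x) (etrans (esym fw) fl).
  by rewrite /= /parity /same_point => ->; rewrite addbb.
rewrite count_cat oddD (negbTE ew) /=.
have -> : count P l = count (same_point x0) l.
  apply: eq_in_count => y yl; apply/asboolP/eqP => [x0y|->//].
  apply: contrapT => /eqP yx0; apply: (hs _ _ x0y); split=> //.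
  by rewrite mem_filter yx0.
by move=> /negP; apply; exact: lx0.
Qed.

Lemma free_tychonoff (R : realType) : tychonoff_space G.
Proof. exact: (bg_tychonoff R) nontrivial_avoids_nbhs. Qed.

Lemma sequentially_compact_words n : sequentially_compact (words n : set G).
Proof.
elim: n => [|n IH] u Wu.
  exists id => //; exists (psum [::]); first by exists [::].
  have -> : u \o id = fun=> psum [::]; last exact: cvg_cst.
  by apply: funext => k /=; have [[]] := Wu k.
have /choice[w hw] k : exists xf, words n xf.2 /\ u k = padd (gen xf.1) xf.2.
  have [[|x l] //= [ln] ->] := Wu k; exists (x, psum l); split; first by exists l.
  exact: (psum_cat _ [:: x] l).
have [phi ip [f Wf ff]] := IH (fun k => (w k).2) (fun k => (hw k).1).
have [psi ips [x hx]] := conv_seq_compact mT (fun k => (w (phi k)).1).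
exists (phi \o psi); first exact: increasing_comp.
exists (padd (gen x) f).
  by rewrite -add1n; apply: words_padd => //; exists [:: x].
have -> : u \o (phi \o psi) =
    fun k => padd (gen (w (phi (psi k))).1) (w (phi (psi k))).2.
  by apply: funext => k /=; case: (hw (phi (psi k))).
exact: (bg_cvgM (cvg_gen hx) (bg_cvg_subseq ips ff)).
Qed.

Lemma sequentially_compact_add_edge (W : set G) s :
  sequentially_compact W -> sequentially_compact (add_edge W s : set G).
Proof.
move=> scW u Wu.
have /choice[w hw] k : exists fxy : G * X * X,
    [/\ W fxy.1.1, agree s fxy.1.2 fxy.2 & u k = padd fxy.1.1 (psum [:: fxy.1.2; fxy.2])].
  by have [f [x [y []]]] := Wu k; exists (f, x, y).
have [|phi ip [f Wf ff]] := scW (fun k => (w k).1.1); first by move=> k; case: (hw k).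
have [psi ips [x hx]] := conv_seq_compact mT (fun k => (w (phi k)).1.2).
have [xi ixi [y hy]] := conv_seq_compact mT (fun k => (w (phi (psi k))).2).
have {}hx := conv_subseq ixi hx.
have {}ff := bg_cvg_subseq (increasing_comp ips ixi) ff.
exists (phi \o (psi \o xi)); first exact/increasing_comp/increasing_comp.
exists (padd f (psum [:: x; y])).
  exists f, x, y; split=> //.
  have [m hm] := conv_agree s hx; have [p hp] := conv_agree s hy.
  move=> j js; have := hm _ (leq_maxl m p) j js; have := hp _ (leq_maxr m p) j js.
  have [_ /(_ j js) + _] := hw (phi (psi (xi (maxn m p)))).
  by rewrite /=; tauto.
have -> : u \o (phi \o (psi \o xi)) = fun k => let fxy := w (phi (psi (xi k))) in
    padd fxy.1.1 (padd (gen fxy.1.2) (gen fxy.2)).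
  by apply: funext => k /=; have [_ _ ->] := hw (phi (psi (xi k))); rewrite psum2.
rewrite psum2; exact: (bg_cvgM ff (bg_cvgM (cvg_gen hx) (cvg_gen hy))).
Qed.

Lemma closed_of_words (A : set G) :
  (forall n (u : nat -> G) g, (forall k, A (u k)) -> (forall k, words n (u k)) ->
     words n g -> u @ \oo --> g -> A g) ->
  closed A.
Proof.
move=> hA; rewrite -openC openE => g nAg; apply/nbhs_bgP.
(* The invariant of the partial edge sums: sequential compactness keeps the forbidden pairs closed,
   and the bounded word length makes [hA] applicable. *)
pose inv (W : set G) := [/\ exists n, W `<=` words n, sequentially_compact W &
  forall w, W w -> ~ A (padd g w)].
have /choice[F hF] (W : set G) : exists s, inv W -> inv (add_edge W s).
  case: (pselect (inv W)) => [[[n Wn] scW WA]|]; last by exists [::].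
  pose Z x y := exists2 w, W w & A (padd g (padd w (psum [:: x; y]))).
  have [|x [w Ww]|s hs] := @agree_separates O T mT Z.
  - move=> u v x y ux vy hZ.
    have /choice[w hw] k : exists w, W w /\ A (padd g (padd w (psum [:: u k; v k]))).
      by have [w] := hZ k; exists w.
    have [|phi ip [f Wf ff]] := scW w; first by move=> k; case: (hw k).
    exists f => //; have [p gp] := words_ex g.
    (* [g] is a word of length [p], elements of [W] have length [n], and an edge adds 2. *)
    apply: (hA (p + (n + 2))%N
        (fun k => padd g (padd (w (phi k)) (psum [:: u (phi k); v (phi k)])))).
    - by move=> k; case: (hw (phi k)).
    - move=> k; apply: words_padd => //; apply: words_padd.
        by apply: Wn; case: (hw (phi k)).
      by exists [:: u (phi k); v (phi k)].
    - apply: words_padd => //; apply: words_padd; first exact: Wn.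
      by exists [:: x; y].
    - have -> : (fun k => padd g (padd (w (phi k)) (psum [:: u (phi k); v (phi k)]))) =
          fun k => padd g (padd (w (phi k)) (padd (gen (u (phi k))) (gen (v (phi k))))).
        by apply: funext => k; rewrite psum2.
      rewrite psum2.
      have uv := bg_cvgM (cvg_gen (conv_subseq ip ux)) (cvg_gen (conv_subseq ip vy)).
      exact: (bg_cvgM (cvg_cst g : (fun _ : nat => g : G) @ \oo --> g) (bg_cvgM ff uv)).
  - by rewrite psum_pair padd0r; exact: WA.
  exists s => _; split.
  - exists (n + 2)%N => _ [w [x [y [Ww _ ->]]]]; apply: words_padd; first exact: Wn.
    by exists [:: x; y].
  - exact: sequentially_compact_add_edge.
  - by move=> _ [w [x [y [Ww xy ->]]]] Aw; apply: (hs _ _ xy); exists w.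
(* The lists and their edge sums arise together: [W n] depends only on the first [n] lists chosen by
   [F]. *)
pose W := fix W n := if n is n'.+1 then add_edge (W n') (F (W n')) else [set psum [::] : G].
exists (fun n => F (W n)) => y [n hn].
have WE : edge_sums (fun n => F (W n)) n = W n.
  by elim: n {hn} => //= n ->.
have invW m : inv (W m).
  elim: m => [|m IH] /=; last exact: hF.
  split=> [|u hu|_ ->]; [by exists 0 => _ ->; exists [::]| |by rewrite padd0r].
  exists id => //; exists (psum [::]) => //.
  have -> : u \o id = fun=> psum [::]; last exact: cvg_cst.
  by apply: funext => k /=; exact: hu.
have [_ _ /(_ (padd g y))] := invW n; rewrite -WE => /(_ hn).
by rewrite paddA paddxx padd0.
Qed.

End free_group.

(** * Sequentiality, countably compact and compact families in the free group *)

Section free_group_properties.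
Variables (O : omega1) (T : O -> set nat).
Hypothesis mT : maximal_tower T.
Local Notation X := (tower_space O).
Local Notation G := (free_group T).
Local Notation gen := (@gen O T).
Local Notation words := (@words O T).
Local Notation psum := (@psum X X (@same_point O)).

(** Each generator of a sum is moved to a nearby point of the dense sequence, at the cost of one
    edge per generator. *)
Lemma free_separable : separable_space G.
Proof.
have [d hd] := tower_space_separable mT.
exists (range (fun l : seq nat => psum (map d l) : G)).
  exact: (sub_countable (card_image_le _ _) (countableP _)).
move=> U [g Ug] oU.
have /nbhs_bgP[s hs] : nbhs g U by exact: open_nbhs_nbhs.
have [l gl] := psumP g.
have [l' hl'] : exists l', edge_sums T s (size l) (padd (psum l) (psum (map d l'))).
  elim: l {gl} => [|x l [l' hl']]; first by exists [::]; rewrite padd0.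
  have [u hu] := hd x; have [m hm] := conv_agree (s (size l)) hu.
  exists (u m :: l'); exists (padd (psum l) (psum (map d l'))), x, (d (u m)).
  split=> //; first by move=> j js; have := hm m (leqnn m) j js; rewrite /=; tauto.
  rewrite (psum_cat _ [:: x] l) (psum_cat _ [:: d (u m)] (map d l')).
  rewrite (psum_cat _ [:: x] [:: d (u m)]).
  by rewrite [RHS]paddC; exact: (@bg_op_cancel (free_base T)).
exists (psum (map d l') : G); split; last by exists l'.
by apply: hs; exists (size l); rewrite gl.
Qed.

Lemma free_sequential : sequential_space G.
Proof.
move=> A nA; apply: contrapT => nu; apply: nA; apply: (closed_of_words mT).
move=> n u g Au _ _ ug; apply: contrapT => nAg; apply: nu.
by exists u, g.
Qed.

Lemma free_c_omega : c_omega_space G.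
Proof.
exists (range words); split.
- exact: (sub_countable (card_image_le _ _) (countableP _)).
- move=> _ [n _ <-]; apply: sequentially_compact_countably_compact.
  exact: sequentially_compact_words.
- move=> U; split=> [oU _ [n _ <-]|oU].
    by rewrite open_subspaceIT; exact: open_subspaceW.
  rewrite -[U]setCK openC; apply: (closed_of_words mT) => n u g nUu wu wg ug Ug.
  have := oU (words n) (ex_intro2 _ _ n I erefl).
  rewrite open_subspaceIT => /open_subspaceP[V oV VU].
  have Vg : V g by have : (U `&` words n) g by []; rewrite -VU => -[].
  have /ug[m _ /(_ m (leqnn m)) Vm] : nbhs g V by exact: open_nbhs_nbhs.
  by apply: (nUu m); have : (V `&` words n) (u m) by []; rewrite VU => -[].
Qed.

Let sep := @nontrivial_avoids_nbhs O T mT.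

(** A sequence of generators has a subsequence converging to a generator, and limits in the group
    are unique. *)
Lemma closed_gen (S : set X) :
  (forall u x, conv T u x -> (forall k, S (u k)) -> S x) -> closed (gen @` S).
Proof.
move=> Sc; apply: (closed_of_words mT) => n u g Su _ _ ug.
have /choice[v hv] k : exists x, S x /\ gen x = u k by have [x] := Su k; exists x.
have [phi ip [x hx]] := conv_seq_compact mT v.
exists x; first by apply: Sc hx _ => k; case: (hv (phi k)).
apply: (bg_cvg_unique (u := u \o phi) sep); last exact: bg_cvg_subseq.
have -> : u \o phi = fun k => gen ((v \o phi) k).
  by apply: funext => k /=; case: (hv (phi k)).
exact: cvg_gen.
Qed.

Lemma gen_inj : injective gen.
Proof.
move=> x y /(congr1 (fun g => sval g x)).
by rewrite /= /parity /= !addn0 /same_point eqxx; case: eqP.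
Qed.

Lemma gen_not_in_compact (C : set G) : compact C -> ~ range gen `<=` C.
Proof.
rewrite (@compact_cover G) => cC sub.
(* An open set that meets the generators exactly in those from [subbasic T j]; a finite subcover
   would contradict [subbasic_no_finite_cover]. *)
pose U (j : {classic X}) : set G := ~` (gen @` [set x | ~ subbasic T j x]).
have [||D _ CD] := cC {classic X} setT U.
- move=> j _; apply: closed_openC; apply: closed_gen => u x ux nu.
  exact: conv_not_subbasic ux nu.
- move=> g _; case: (pselect (range gen g)) => [[x _ <-]|ng].
    exists (x : {classic X}) => // -[y ny /gen_inj yx]; apply: ny; rewrite yx.
    exact: subbasic_self.
  by exists (inl 0 : X) => // -[y _ yg]; apply: ng; exists y.
have [x hx] := subbasic_no_finite_cover T (enum_fset D : seq X).
have /sub/CD[j /= jD] : range gen (gen x) by exists x.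
apply; exists x => //; apply: hx.
have {}jD : j \in enum_fset D := jD.
elim: (enum_fset D) jD => //= a l IH.
by rewrite inE => /predU1P[->|/IH]; [left|right].
Qed.

(** Otherwise generators of points [x n] are chosen outside growing compact sets [C n], which absorb
    the members of [F] and the earlier choices. Each member of [F] contains only finitely many of
    them, so a convergent subsequence without its limit would be closed. *)
Lemma free_not_k_omega : ~ k_omega_space G.
Proof.
move=> [F [cF kF dF]].
have [e he] : exists e : nat -> set G, forall K, F K -> exists n, e n = K.
  have [e Fe] := pcard_surjP cF.
  by exists e => K /Fe[n _ <-]; exists n.
pose e' n : set G := if pselect (F (e n)) then e n else set0.
have ce' n : compact (e' n).
  by rewrite /e'; case: pselect => [Fe|nFe]; [exact: kF|exact: compact0].
have /choice[h hh] (C : set G) : exists x, compact C -> ~ C (gen x).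
  case: (pselect (compact C)) => [cC|nC]; last by exists (inl 0).
  apply: contrapT => /forallNP nx; apply: (gen_not_in_compact cC) => _ [x _ <-].
  by apply: contrapT => nCx; exact: nx x (fun=> nCx).
pose C := fix C n : set G :=
  if n is n'.+1 then C n' `|` (e' n' `|` [set gen (h (C n'))]) else set0.
have cC n : compact (C n).
  elim: n => [|n IH] /=; first exact: compact0.
  by apply: compactU => //; apply: compactU => //; exact: compact_set1.
have CS n m : (n < m)%N -> C n.+1 `<=` C m.
  elim: m => // m IH; rewrite ltnS leq_eqVlt => /predU1P[->//|/IH nm].
  by apply: subset_trans nm _; left.
pose x n := h (C n).
have nCx n : ~ C n (gen (x n)) by exact: hh (cC n).
have xinj n m : (n < m)%N -> x n <> x m.
  move=> nm xnm; apply: (nCx m); apply: (CS _ _ nm); rewrite -xnm.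
  by right; right.
have xK K : F K -> exists i, forall n, (i < n)%N -> ~ K (gen (x n)).
  move=> FK; have [i ei] := he K FK; exists i => n ni Kx; apply: (nCx n).
  apply: (CS _ _ ni); right; left; rewrite /e' ei.
  by case: pselect.
have [phi ip [y hy]] := conv_seq_compact mT x.
(* Removing [gen y] makes the complement of [S] a neighbourhood of the limit. *)
pose S : set G := [set g | (exists j, g = gen (x (phi j))) /\ g <> gen y].
have acc : accessible_space G := bg_accessible sep.
have oS : open (~` S).
  apply/dF => K FK; rewrite open_subspaceIT; apply/open_subspaceP.
  have [i hi] := xK K FK.
  pose Si := S `&` ((fun n => gen (x n)) @` [set n | (n < i.+1)%N]).
  exists (~` Si).
    apply: closed_openC; apply: (iffLR (@accessible_finite_set_closed G) acc).
    by apply: finite_setIr; apply: finite_image; exact: finite_II.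
  apply/seteqP; split=> g [nS Kg]; split=> //; last by move=> [].
  move=> Sg; apply: nS; split=> //; case: Sg => -[j gj] _.
  exists (phi j) => //; rewrite /= ltnS leqNgt; apply/negP => /hi; apply.
  by rewrite -gj.
have : nbhs (gen y) (~` S) by apply: open_nbhs_nbhs; split=> // -[].
move=> /(cvg_gen hy)[m _ hm].
(* The subsequence is eventually constant, although the [x n] are distinct. *)
have eqy k : (m <= k)%N -> x (phi k) = y.
  move=> /hm /= nS; apply: gen_inj; apply: contrapT => ne; apply: nS; split=> //.
  by exists k.
by apply: (xinj (phi m) (phi m.+1)); [exact: ip|rewrite !eqy].
Qed.

End free_group_properties.

Theorem mainTheorem6 (R : realType) :
  ~ (exists G : topologicalGroupType,
       [/\ tychonoff_space G, separable_space G, frechet_space G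
         & ~ metrizable_space R G]) ->
  exists G : topologicalGroupType,
    [/\ tychonoff_space G, separable_space G, sequential_space G,
        c_omega_space G & ~ k_omega_space G].
Proof.
move=> /maximal_tower_exists[W [T mT]]; exists (free_group T); split.
- exact: free_tychonoff R.
- exact: free_separable.
- exact: free_sequential.
- exact: free_c_omega.
- exact: free_not_k_omega.
Qed.
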